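(* The intuitionistic version of $\mathbf{ACA}$ is interpretable in $\mathbf{emTT}$, the extensional level of the Minimalist Foundation. Hence (classical) $\mathbf{ACA}$ can be interpreted in the classical version of $\mathbf{emTT}$, i.e. $\mathbf{emTT}$ extended with $\phi\lor\neg\phi$ for all propositions $\phi$.
   Context: $\mathbf{ACA}$ is the subsystem of second-order arithmetic, in the two-sorted language with number variables, set variables $X,Y,\dots$ and atomic formulas $s=t$ and $t\in X$, whose axioms are the Peano axioms for zero and successor (and the arithmetical operations), the induction scheme for all formulas of the language, and the arithmetical comprehension scheme $\exists X\forall x(x\in X\leftrightarrow\phi(x))$ for formulas $\phi$ without set quantifiers (set parameters allowed) in which $X$ is not free. Its intuitionistic version has the same axioms over intuitionistic logic. The interpretation is meant to preserve the meaning of the logical operators: connectives and quantifiers are translated as connectives and quantifiers of $\mathbf{emTT}$, and derivable formulas are translated to propositions that are derivably true. $\mathbf{emTT}$ is a dependent type theory in the style of extensional Martin-Löf type theory with four kinds of types: small propositions ($\mathit{prop}_s$), propositions ($\mathit{prop}$), sets, and collections. Every small proposition is a proposition and a set; every set and every proposition is a collection. Judgements are of the form $A$ type, $A=B$ type, $a\in A$, $a=b\in A$ in context. Sets: the empty set $N_0$, the singleton $N_1$, lists $List(A)$ over a set $A$ (hence the natural numbers $\mathsf{N}$), $\Sigma_{x\in A}B(x)$ and $\Pi_{x\in A}B(x)$ for families of sets over a set, disjoint sums $A+B$, effective quotients $A/R$ of a set by a small equivalence relation $R(x,y)\ \mathit{prop}_s\ [x\in A,y\in A]$, and small propositions. The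 rules are those of first-order extensional Martin-Löf type theory; inductive sets have elimination rules towards all collections. Collections: sets, propositions, $\Sigma_{x\in A}B(x)$ for families of collections, the power-collection of the singleton $\mathcal{P}(1)$, and $\mathcal{P}(A)\equiv A\to\mathcal{P}(1)$ for a set $A$. $\mathcal{P}(1)$ is the quotient of the collection of small propositions by equiprovability: each small proposition $\phi$ gives $[\phi]\in\mathcal{P}(1)$; $[\phi]=[\psi]$ if and only if $\phi\leftrightarrow\psi$ is true; and each $U\in\mathcal{P}(1)$ equals $[\mathsf{Eq}(\mathcal{P}(1),U,[\top])]$, where $\mathsf{Eq}(\mathcal{P}(1),U,V)$ is a small proposition. Elements of $\mathcal{P}(A)$ are $\lambda$-terms with $\beta$ and $\eta$ rules. For $X\in\mathcal{P}(A)$ and $t\in A$, $t\mathrel{\varepsilon}X$ is $\mathsf{Eq}(\mathcal{P}(1),X(t),[\top])$, and for a small $\phi(x)$, $t\mathrel{\varepsilon}\{x\in A\mid\phi(x)\}\leftrightarrow\phi(t)$ is true. Propositions: falsum, conjunction, disjunction, implication, quantifiers $\forall_{x\in A},\exists_{x\in A}$ over collections $A$, and extensional equality $\mathsf{Eq}(A,a,b)$ (with the reflection rule: if it is true then $a=b\in A$). Small propositions are those closed under connectives and under quantifiers and equalities restricted to sets. The rules are intuitionistic; propositions are proof-irrelevant with one canonical element $\mathsf{true}$; elimination rules of propositions act only towards propositions. *)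

(* Defs.v *)
From Stdlib Require Import List.
Import ListNotations.

(* The logic of a formal system: [classical] adds excluded middle. *)
Inductive logic : Set := intuitionistic | classical.

(* Number variables and set variables are de Bruijn indices living in two
   separate index spaces: [fAllN], [fExN] bind number variable 0, and
   [fAllS], [fExS] bind set variable 0. *)

Inductive nterm : Set :=
| nVar (x : nat)
| nZero
| nSucc (t : nterm)
| nPlus (t u : nterm)
| nTimes (t u : nterm).

Inductive form : Set :=
| fEq (t u : nterm)
| fIn (t : nterm) (X : nat)
| fBot
| fAnd (p q : form)
| fOr (p q : form)
| fImp (p q : form)
| fAllN (p : form)
| fExN (p : form)
| fAllS (p : form)
| fExS (p : form).

Definition fNot (p : form) : form := fImp p fBot.
Definition fIff (p q : form) : form := fAnd (fImp p q) (fImp q p).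

Definition scons {T : Type} (a : T) (s : nat -> T) (i : nat) : T :=
  match i with 0 => a | S j => s j end.

Fixpoint nsubst (s : nat -> nterm) (t : nterm) : nterm :=
  match t with
  | nVar x => s x
  | nZero => nZero
  | nSucc t => nSucc (nsubst s t)
  | nPlus t u => nPlus (nsubst s t) (nsubst s u)
  | nTimes t u => nTimes (nsubst s t) (nsubst s u)
  end.

Definition nlift : nterm -> nterm := nsubst (fun x => nVar (S x)).

Definition nup (s : nat -> nterm) : nat -> nterm :=
  scons (nVar 0) (fun x => nlift (s x)).

Definition rup (r : nat -> nat) : nat -> nat := scons 0 (fun X => S (r X)).

(* Set variables are the only set terms, so they are replaced by set variables. *)
Fixpoint fsubst (s : nat -> nterm) (r : nat -> nat) (p : form) : form :=
  match p with
  | fEq t u => fEq (nsubst s t) (nsubst s u)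
  | fIn t X => fIn (nsubst s t) (r X)
  | fBot => fBot
  | fAnd p q => fAnd (fsubst s r p) (fsubst s r q)
  | fOr p q => fOr (fsubst s r p) (fsubst s r q)
  | fImp p q => fImp (fsubst s r p) (fsubst s r q)
  | fAllN p => fAllN (fsubst (nup s) r p)
  | fExN p => fExN (fsubst (nup s) r p)
  | fAllS p => fAllS (fsubst s (rup r) p)
  | fExS p => fExS (fsubst s (rup r) p)
  end.

Definition liftN : form -> form := fsubst (fun x => nVar (S x)) (fun X => X).
Definition liftS : form -> form := fsubst nVar S.
Definition instN (t : nterm) : form -> form :=
  fsubst (scons t nVar) (fun X => X).
Definition instS (X : nat) : form -> form :=
  fsubst nVar (scons X (fun Y => Y)).

Fixpoint nscoped (n : nat) (t : nterm) : Prop :=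
  match t with
  | nVar x => x < n
  | nZero => True
  | nSucc t => nscoped n t
  | nPlus t u | nTimes t u => nscoped n t /\ nscoped n u
  end.

(* [scoped n m p]: the free number (resp. set) variables of [p] are among the
   first [n] (resp. [m]) ones. *)
Fixpoint scoped (n m : nat) (p : form) : Prop :=
  match p with
  | fEq t u => nscoped n t /\ nscoped n u
  | fIn t X => nscoped n t /\ X < m
  | fBot => True
  | fAnd p q | fOr p q | fImp p q => scoped n m p /\ scoped n m q
  | fAllN p | fExN p => scoped (S n) m p
  | fAllS p | fExS p => scoped n (S m) p
  end.

Fixpoint arithmetical (p : form) : Prop :=
  match p with
  | fEq _ _ | fIn _ _ | fBot => True
  | fAnd p q | fOr p q | fImp p q => arithmetical p /\ arithmetical q
  | fAllN p | fExN p => arithmetical p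
  | fAllS _ | fExS _ => False
  end.

(* Axioms may contain free variables (parameters); they are available under
   any assumptions, hence so are their universal closures. *)
Inductive ACA_axiom : form -> Prop :=
| ax_succ_ne_zero :
    ACA_axiom (fAllN (fNot (fEq (nSucc (nVar 0)) nZero)))
| ax_succ_inj :
    ACA_axiom (fAllN (fAllN
      (fImp (fEq (nSucc (nVar 1)) (nSucc (nVar 0))) (fEq (nVar 1) (nVar 0)))))
| ax_plus_zero :
    ACA_axiom (fAllN (fEq (nPlus (nVar 0) nZero) (nVar 0)))
| ax_plus_succ :
    ACA_axiom (fAllN (fAllN
      (fEq (nPlus (nVar 1) (nSucc (nVar 0))) (nSucc (nPlus (nVar 1) (nVar 0))))))
| ax_times_zero :
    ACA_axiom (fAllN (fEq (nTimes (nVar 0) nZero) nZero))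
| ax_times_succ :
    ACA_axiom (fAllN (fAllN
      (fEq (nTimes (nVar 1) (nSucc (nVar 0)))
           (nPlus (nTimes (nVar 1) (nVar 0)) (nVar 1)))))
| ax_induction (p : form) :
    ACA_axiom
      (fImp (instN nZero p)
      (fImp (fAllN (fImp p
               (fsubst (scons (nSucc (nVar 0)) (fun x => nVar (S x)))
                       (fun X => X) p)))
            (fAllN p)))
(* [p] has the bound number variable as variable 0; [liftS] makes sure that
   the set variable being introduced is not free in it. *)
| ax_comprehension (p : form) :
    arithmetical p ->
    ACA_axiom (fExS (fAllN (fIff (fIn (nVar 0) 0) (liftS p)))).

(* Two-sorted natural deduction with equality of numbers, over the axioms above. *)
Inductive deriv (L : logic) : list form -> form -> Prop :=
| d_axiom G p : ACA_axiom p -> deriv L G p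
| d_hyp G p : In p G -> deriv L G p
| d_botE G p : deriv L G fBot -> deriv L G p
| d_andI G p q : deriv L G p -> deriv L G q -> deriv L G (fAnd p q)
| d_andE1 G p q : deriv L G (fAnd p q) -> deriv L G p
| d_andE2 G p q : deriv L G (fAnd p q) -> deriv L G q
| d_orI1 G p q : deriv L G p -> deriv L G (fOr p q)
| d_orI2 G p q : deriv L G q -> deriv L G (fOr p q)
| d_orE G p q r :
    deriv L G (fOr p q) -> deriv L (p :: G) r -> deriv L (q :: G) r ->
    deriv L G r
| d_impI G p q : deriv L (p :: G) q -> deriv L G (fImp p q)
| d_impE G p q : deriv L G (fImp p q) -> deriv L G p -> deriv L G q
| d_allNI G p : deriv L (map liftN G) p -> deriv L G (fAllN p)
| d_allNE G p t : deriv L G (fAllN p) -> deriv L G (instN t p)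
| d_exNI G p t : deriv L G (instN t p) -> deriv L G (fExN p)
| d_exNE G p q :
    deriv L G (fExN p) -> deriv L (p :: map liftN G) (liftN q) -> deriv L G q
| d_allSI G p : deriv L (map liftS G) p -> deriv L G (fAllS p)
| d_allSE G p X : deriv L G (fAllS p) -> deriv L G (instS X p)
| d_exSI G p X : deriv L G (instS X p) -> deriv L G (fExS p)
| d_exSE G p q :
    deriv L G (fExS p) -> deriv L (p :: map liftS G) (liftS q) -> deriv L G q
| d_eqI G t : deriv L G (fEq t t)
| d_eqE G t u p :
    deriv L G (fEq t u) -> deriv L G (instN t p) -> deriv L G (instN u p)
| d_lem G p : L = classical -> deriv L G (fOr p (fNot p)).

(* The theorems (possibly with free variables) of ACA over the logic [L]. *)
Definition ACA (L : logic) (p : form) : Prop := deriv L [] p.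

(* Pre-syntax: types, propositions and terms share one grammar, with one space
   of de Bruijn indices.  Numbers of variables bound in an argument are
   indicated; the variable introduced last has index 0. *)
Inductive expr : Set :=
| var (n : nat)
| N0
| N1
| List (A : expr)
| Sigma (A B : expr)            (* 1 in B *)
| Pi (A B : expr)               (* 1 in B *)
| Sum (A B : expr)
| Quot (A R : expr)             (* 2 in R *)
| P1                            (* the power-collection of the singleton *)
| Pow (A : expr)                (* A -> P(1) *)
| Fls
| And (B C : expr)
| Or (B C : expr)
| Imp (B C : expr)
| All (A B : expr)              (* 1 in B *)
| Ex (A B : expr)               (* 1 in B *)
| Eq (A a b : expr)
| emp0 (a : expr)               (* elimination of N0 *)
| star
| elN1 (a c : expr)
| eps                           (* the empty list *)
| snoc (s a : expr)             (* the list s followed by a *)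
| elList (a l c : expr)         (* 3 in c: list, last element, recursive value *)
| pair (a b : expr)
| elSigma (d m : expr)          (* 2 in m *)
| lam (b : expr)                (* 1 in b *)
| app (f a : expr)
| inl (a : expr)
| inr (b : expr)
| elSum (d l r : expr)          (* 1 in l, 1 in r *)
| cls (a : expr)                (* the class of a in a quotient set *)
| elQuot (p l : expr)           (* 1 in l *)
| code (B : expr)               (* [B] in P(1), for B a small proposition *)
| true.                         (* the canonical proof *)

Definition up_ren (r : nat -> nat) : nat -> nat := scons 0 (fun i => S (r i)).

Fixpoint ren (r : nat -> nat) (e : expr) : expr :=
  match e with
  | var n => var (r n)
  | N0 => N0
  | N1 => N1
  | List A => List (ren r A)
  | Sigma A B => Sigma (ren r A) (ren (up_ren r) B)
  | Pi A B => Pi (ren r A) (ren (up_ren r) B)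
  | Sum A B => Sum (ren r A) (ren r B)
  | Quot A R => Quot (ren r A) (ren (up_ren (up_ren r)) R)
  | P1 => P1
  | Pow A => Pow (ren r A)
  | Fls => Fls
  | And B C => And (ren r B) (ren r C)
  | Or B C => Or (ren r B) (ren r C)
  | Imp B C => Imp (ren r B) (ren r C)
  | All A B => All (ren r A) (ren (up_ren r) B)
  | Ex A B => Ex (ren r A) (ren (up_ren r) B)
  | Eq A a b => Eq (ren r A) (ren r a) (ren r b)
  | emp0 a => emp0 (ren r a)
  | star => star
  | elN1 a c => elN1 (ren r a) (ren r c)
  | eps => eps
  | snoc s a => snoc (ren r s) (ren r a)
  | elList a l c =>
      elList (ren r a) (ren r l) (ren (up_ren (up_ren (up_ren r))) c)
  | pair a b => pair (ren r a) (ren r b)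
  | elSigma d m => elSigma (ren r d) (ren (up_ren (up_ren r)) m)
  | lam b => lam (ren (up_ren r) b)
  | app f a => app (ren r f) (ren r a)
  | inl a => inl (ren r a)
  | inr b => inr (ren r b)
  | elSum d l m => elSum (ren r d) (ren (up_ren r) l) (ren (up_ren r) m)
  | cls a => cls (ren r a)
  | elQuot p l => elQuot (ren r p) (ren (up_ren r) l)
  | code B => code (ren r B)
  | true => true
  end.

Definition shift (k : nat) : expr -> expr := ren (fun i => k + i).

Definition up (s : nat -> expr) : nat -> expr :=
  scons (var 0) (fun i => shift 1 (s i)).

Fixpoint subst (s : nat -> expr) (e : expr) : expr :=
  match e with
  | var n => s n
  | N0 => N0
  | N1 => N1
  | List A => List (subst s A)
  | Sigma A B => Sigma (subst s A) (subst (up s) B)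
  | Pi A B => Pi (subst s A) (subst (up s) B)
  | Sum A B => Sum (subst s A) (subst s B)
  | Quot A R => Quot (subst s A) (subst (up (up s)) R)
  | P1 => P1
  | Pow A => Pow (subst s A)
  | Fls => Fls
  | And B C => And (subst s B) (subst s C)
  | Or B C => Or (subst s B) (subst s C)
  | Imp B C => Imp (subst s B) (subst s C)
  | All A B => All (subst s A) (subst (up s) B)
  | Ex A B => Ex (subst s A) (subst (up s) B)
  | Eq A a b => Eq (subst s A) (subst s a) (subst s b)
  | emp0 a => emp0 (subst s a)
  | star => star
  | elN1 a c => elN1 (subst s a) (subst s c)
  | eps => eps
  | snoc u a => snoc (subst s u) (subst s a)
  | elList a l c => elList (subst s a) (subst s l) (subst (up (up (up s))) c)
  | pair a b => pair (subst s a) (subst s b)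
  | elSigma d m => elSigma (subst s d) (subst (up (up s)) m)
  | lam b => lam (subst (up s) b)
  | app f a => app (subst s f) (subst s a)
  | inl a => inl (subst s a)
  | inr b => inr (subst s b)
  | elSum d l m => elSum (subst s d) (subst (up s) l) (subst (up s) m)
  | cls a => cls (subst s a)
  | elQuot p l => elQuot (subst s p) (subst (up s) l)
  | code B => code (subst s B)
  | true => true
  end.

(* For B(x) over a context (x, Gamma) and [a] over an extension of Gamma by
   [k] variables, [inst k a B] is B(a) over that extension; likewise
   [inst2 k a b R] is R(a,b) for R(x,y) over (y, x, Gamma). *)
Definition inst (k : nat) (a B : expr) : expr :=
  subst (scons a (fun i => var (k + i))) B.
Definition inst2 (k : nat) (a b R : expr) : expr :=
  subst (scons b (scons a (fun i => var (k + i)))) R.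
Definition inst3 (k : nat) (a b c M : expr) : expr :=
  subst (scons c (scons b (scons a (fun i => var (k + i))))) M.

Definition Neg (B : expr) : expr := Imp B Fls.
Definition Iff (B C : expr) : expr := And (Imp B C) (Imp C B).
Definition Top : expr := Imp Fls Fls.

Inductive size : Set := small | large.

(* [typ small], [typ large], [prp small], [prp large] are the sets, the
   collections, the small propositions and the propositions. *)
Inductive kind : Set := typ (s : size) | prp (s : size).
Notation set_ := (typ small).
Notation coll := (typ large).
Notation prop_s := (prp small).
Notation prop := (prp large).

(* The head of a context is the type of the variable of index 0. *)
Definition ctx : Set := list expr.

Inductive judgement : Set :=
| Cont                              (* the context is well formed *)
| Ty (k : kind) (A : expr)          (* A type, of kind k *)
| TyEq (k : kind) (A B : expr)      (* A = B type, of kind k *)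
| El (a A : expr)                   (* a in A *)
| ElEq (a b A : expr).              (* a = b in A *)

Definition jsubst (s : nat -> expr) (J : judgement) : judgement :=
  match J with
  | Cont => Cont
  | Ty k A => Ty k (subst s A)
  | TyEq k A B => TyEq k (subst s A) (subst s B)
  | El a A => El (subst s a) (subst s A)
  | ElEq a b A => ElEq (subst s a) (subst s b) (subst s A)
  end.

Reserved Notation "G |-- J" (at level 70, J at next level).

(* Congruence rules are given for the type formers and for the term formers
   that bind variables; congruence of the other term formers is an instance of
   [r_subst_El]. *)
Inductive emTT (L : logic) : ctx -> judgement -> Prop :=

| r_nil : [] |-- Cont
| r_cons G A : G |-- Ty coll A -> A :: G |-- Cont
| r_var G n A :
    G |-- Cont -> nth_error G n = Some A -> G |-- El (var n) (shift (S n) A)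
| r_subst G D J (s : nat -> expr) :
    G |-- J -> D |-- Cont ->
    (forall n A, nth_error G n = Some A ->
       D |-- El (s n) (subst s (shift (S n) A))) ->
    D |-- jsubst s J
| r_subst_Ty G D k A (s t : nat -> expr) :
    G |-- Ty k A -> D |-- Cont ->
    (forall n C, nth_error G n = Some C ->
       D |-- ElEq (s n) (t n) (subst s (shift (S n) C))) ->
    D |-- TyEq k (subst s A) (subst t A)
| r_subst_El G D a A (s t : nat -> expr) :
    G |-- El a A -> D |-- Cont ->
    (forall n C, nth_error G n = Some C ->
       D |-- ElEq (s n) (t n) (subst s (shift (S n) C))) ->
    D |-- ElEq (subst s a) (subst t a) (subst s A)

| r_TyEq_refl G k A : G |-- Ty k A -> G |-- TyEq k A A
| r_TyEq_sym G k A B : G |-- TyEq k A B -> G |-- TyEq k B A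
| r_TyEq_trans G k A B C :
    G |-- TyEq k A B -> G |-- TyEq k B C -> G |-- TyEq k A C
| r_ElEq_refl G a A : G |-- El a A -> G |-- ElEq a a A
| r_ElEq_sym G a b A : G |-- ElEq a b A -> G |-- ElEq b a A
| r_ElEq_trans G a b c A :
    G |-- ElEq a b A -> G |-- ElEq b c A -> G |-- ElEq a c A
| r_conv G a A B : G |-- El a A -> G |-- TyEq coll A B -> G |-- El a B
| r_conv_eq G a b A B :
    G |-- ElEq a b A -> G |-- TyEq coll A B -> G |-- ElEq a b B

| r_prop_s_prop G A : G |-- Ty prop_s A -> G |-- Ty prop A
| r_set_coll G A : G |-- Ty set_ A -> G |-- Ty coll A
| r_prp_typ G s A : G |-- Ty (prp s) A -> G |-- Ty (typ s) A
| r_prop_s_prop_eq G A B : G |-- TyEq prop_s A B -> G |-- TyEq prop A B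
| r_set_coll_eq G A B : G |-- TyEq set_ A B -> G |-- TyEq coll A B
| r_prp_typ_eq G s A B : G |-- TyEq (prp s) A B -> G |-- TyEq (typ s) A B

| r_N0_F G : G |-- Cont -> G |-- Ty set_ N0
| r_N0_E G M a :
    N0 :: G |-- Ty coll M -> G |-- El a N0 -> G |-- El (emp0 a) (inst 0 a M)

| r_N1_F G : G |-- Cont -> G |-- Ty set_ N1
| r_N1_I G : G |-- Cont -> G |-- El star N1
| r_N1_E G M a c :
    N1 :: G |-- Ty coll M -> G |-- El a N1 -> G |-- El c (inst 0 star M) ->
    G |-- El (elN1 a c) (inst 0 a M)
| r_N1_C G M c :
    N1 :: G |-- Ty coll M -> G |-- El c (inst 0 star M) ->
    G |-- ElEq (elN1 star c) c (inst 0 star M)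

| r_List_F G A : G |-- Ty set_ A -> G |-- Ty set_ (List A)
| r_List_eq G A A' :
    G |-- TyEq set_ A A' -> G |-- TyEq set_ (List A) (List A')
| r_List_I1 G A : G |-- Ty set_ A -> G |-- El eps (List A)
| r_List_I2 G A s a :
    G |-- Ty set_ A -> G |-- El s (List A) -> G |-- El a A ->
    G |-- El (snoc s a) (List A)
| r_List_E G A M a l c :
    List A :: G |-- Ty coll M -> G |-- Ty set_ A ->
    G |-- El a (List A) ->
    G |-- El l (inst 0 eps M) ->
    shift 1 M :: shift 1 A :: List A :: G
      |-- El c (inst 3 (snoc (var 2) (var 1)) M) ->
    G |-- El (elList a l c) (inst 0 a M)
| r_List_E_eq G A M a a' l l' c c' :
    List A :: G |-- Ty coll M -> G |-- Ty set_ A ->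
    G |-- ElEq a a' (List A) ->
    G |-- ElEq l l' (inst 0 eps M) ->
    shift 1 M :: shift 1 A :: List A :: G
      |-- ElEq c c' (inst 3 (snoc (var 2) (var 1)) M) ->
    G |-- ElEq (elList a l c) (elList a' l' c') (inst 0 a M)
| r_List_C1 G A M l c :
    List A :: G |-- Ty coll M -> G |-- Ty set_ A ->
    G |-- El l (inst 0 eps M) ->
    shift 1 M :: shift 1 A :: List A :: G
      |-- El c (inst 3 (snoc (var 2) (var 1)) M) ->
    G |-- ElEq (elList eps l c) l (inst 0 eps M)
| r_List_C2 G A M s a l c :
    List A :: G |-- Ty coll M -> G |-- Ty set_ A ->
    G |-- El s (List A) -> G |-- El a A ->
    G |-- El l (inst 0 eps M) ->
    shift 1 M :: shift 1 A :: List A :: G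
      |-- El c (inst 3 (snoc (var 2) (var 1)) M) ->
    G |-- ElEq (elList (snoc s a) l c) (inst3 0 s a (elList s l c) c)
               (inst 0 (snoc s a) M)

| r_Sigma_F G s A B :
    G |-- Ty (typ s) A -> A :: G |-- Ty (typ s) B ->
    G |-- Ty (typ s) (Sigma A B)
| r_Sigma_eq G s A A' B B' :
    G |-- TyEq (typ s) A A' -> A :: G |-- TyEq (typ s) B B' ->
    G |-- TyEq (typ s) (Sigma A B) (Sigma A' B')
| r_Sigma_I G A B a b :
    A :: G |-- Ty coll B -> G |-- El a A -> G |-- El b (inst 0 a B) ->
    G |-- El (pair a b) (Sigma A B)
| r_Sigma_E G A B M d m :
    Sigma A B :: G |-- Ty coll M -> A :: G |-- Ty coll B ->
    G |-- El d (Sigma A B) ->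
    B :: A :: G |-- El m (inst 2 (pair (var 1) (var 0)) M) ->
    G |-- El (elSigma d m) (inst 0 d M)
| r_Sigma_E_eq G A B M d d' m m' :
    Sigma A B :: G |-- Ty coll M -> A :: G |-- Ty coll B ->
    G |-- ElEq d d' (Sigma A B) ->
    B :: A :: G |-- ElEq m m' (inst 2 (pair (var 1) (var 0)) M) ->
    G |-- ElEq (elSigma d m) (elSigma d' m') (inst 0 d M)
| r_Sigma_C G A B M a b m :
    Sigma A B :: G |-- Ty coll M -> A :: G |-- Ty coll B ->
    G |-- El a A -> G |-- El b (inst 0 a B) ->
    B :: A :: G |-- El m (inst 2 (pair (var 1) (var 0)) M) ->
    G |-- ElEq (elSigma (pair a b) m) (inst2 0 a b m) (inst 0 (pair a b) M)

| r_Pi_F G A B :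
    G |-- Ty set_ A -> A :: G |-- Ty set_ B -> G |-- Ty set_ (Pi A B)
| r_Pi_eq G A A' B B' :
    G |-- TyEq set_ A A' -> A :: G |-- TyEq set_ B B' ->
    G |-- TyEq set_ (Pi A B) (Pi A' B')
| r_Pi_I G A B b :
    G |-- Ty set_ A -> A :: G |-- Ty set_ B -> A :: G |-- El b B ->
    G |-- El (lam b) (Pi A B)
| r_Pi_I_eq G A B b b' :
    G |-- Ty set_ A -> A :: G |-- Ty set_ B -> A :: G |-- ElEq b b' B ->
    G |-- ElEq (lam b) (lam b') (Pi A B)
| r_Pi_E G A B f a :
    G |-- Ty set_ A -> A :: G |-- Ty set_ B ->
    G |-- El f (Pi A B) -> G |-- El a A ->
    G |-- El (app f a) (inst 0 a B)
| r_Pi_beta G A B b a :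
    G |-- Ty set_ A -> A :: G |-- Ty set_ B ->
    A :: G |-- El b B -> G |-- El a A ->
    G |-- ElEq (app (lam b) a) (inst 0 a b) (inst 0 a B)
| r_Pi_eta G A B f :
    G |-- Ty set_ A -> A :: G |-- Ty set_ B -> G |-- El f (Pi A B) ->
    G |-- ElEq (lam (app (shift 1 f) (var 0))) f (Pi A B)

| r_Sum_F G A B :
    G |-- Ty set_ A -> G |-- Ty set_ B -> G |-- Ty set_ (Sum A B)
| r_Sum_eq G A A' B B' :
    G |-- TyEq set_ A A' -> G |-- TyEq set_ B B' ->
    G |-- TyEq set_ (Sum A B) (Sum A' B')
| r_Sum_I1 G A B a :
    G |-- Ty set_ A -> G |-- Ty set_ B -> G |-- El a A ->
    G |-- El (inl a) (Sum A B)
| r_Sum_I2 G A B b :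
    G |-- Ty set_ A -> G |-- Ty set_ B -> G |-- El b B ->
    G |-- El (inr b) (Sum A B)
| r_Sum_E G A B M d l r :
    Sum A B :: G |-- Ty coll M ->
    G |-- Ty set_ A -> G |-- Ty set_ B ->
    G |-- El d (Sum A B) ->
    A :: G |-- El l (inst 1 (inl (var 0)) M) ->
    B :: G |-- El r (inst 1 (inr (var 0)) M) ->
    G |-- El (elSum d l r) (inst 0 d M)
| r_Sum_E_eq G A B M d d' l l' r r' :
    Sum A B :: G |-- Ty coll M ->
    G |-- Ty set_ A -> G |-- Ty set_ B ->
    G |-- ElEq d d' (Sum A B) ->
    A :: G |-- ElEq l l' (inst 1 (inl (var 0)) M) ->
    B :: G |-- ElEq r r' (inst 1 (inr (var 0)) M) ->
    G |-- ElEq (elSum d l r) (elSum d' l' r') (inst 0 d M)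
| r_Sum_C1 G A B M a l r :
    Sum A B :: G |-- Ty coll M ->
    G |-- Ty set_ A -> G |-- Ty set_ B ->
    G |-- El a A ->
    A :: G |-- El l (inst 1 (inl (var 0)) M) ->
    B :: G |-- El r (inst 1 (inr (var 0)) M) ->
    G |-- ElEq (elSum (inl a) l r) (inst 0 a l) (inst 0 (inl a) M)
| r_Sum_C2 G A B M b l r :
    Sum A B :: G |-- Ty coll M ->
    G |-- Ty set_ A -> G |-- Ty set_ B ->
    G |-- El b B ->
    A :: G |-- El l (inst 1 (inl (var 0)) M) ->
    B :: G |-- El r (inst 1 (inr (var 0)) M) ->
    G |-- ElEq (elSum (inr b) l r) (inst 0 b r) (inst 0 (inr b) M)

| r_Quot_F G A R :
    G |-- Ty set_ A ->
    shift 1 A :: A :: G |-- Ty prop_s R ->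
    A :: G |-- El true (inst2 1 (var 0) (var 0) R) ->
    R :: shift 1 A :: A :: G |-- El true (inst2 3 (var 1) (var 2) R) ->
    inst2 4 (var 2) (var 1) R :: shift 1 R :: shift 2 A :: shift 1 A :: A :: G
      |-- El true (inst2 5 (var 4) (var 2) R) ->
    G |-- Ty set_ (Quot A R)
| r_Quot_eq G A A' R R' :
    G |-- Ty set_ (Quot A R) -> G |-- Ty set_ (Quot A' R') ->
    G |-- TyEq set_ A A' ->
    shift 1 A :: A :: G |-- TyEq prop_s R R' ->
    G |-- TyEq set_ (Quot A R) (Quot A' R')
| r_Quot_I G A R a :
    G |-- Ty set_ (Quot A R) -> G |-- El a A -> G |-- El (cls a) (Quot A R)
| r_Quot_I_eq G A R a b :
    G |-- Ty set_ (Quot A R) -> G |-- El a A -> G |-- El b A ->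
    G |-- El true (inst2 0 a b R) ->
    G |-- ElEq (cls a) (cls b) (Quot A R)
| r_Quot_E G A R M p l :
    G |-- Ty set_ (Quot A R) -> Quot A R :: G |-- Ty coll M ->
    G |-- El p (Quot A R) ->
    A :: G |-- El l (inst 1 (cls (var 0)) M) ->
    R :: shift 1 A :: A :: G
      |-- ElEq (inst 3 (var 2) l) (inst 3 (var 1) l) (inst 3 (cls (var 2)) M) ->
    G |-- El (elQuot p l) (inst 0 p M)
| r_Quot_E_eq G A R M p p' l l' :
    G |-- Ty set_ (Quot A R) -> Quot A R :: G |-- Ty coll M ->
    G |-- ElEq p p' (Quot A R) ->
    A :: G |-- ElEq l l' (inst 1 (cls (var 0)) M) ->
    R :: shift 1 A :: A :: G
      |-- ElEq (inst 3 (var 2) l) (inst 3 (var 1) l) (inst 3 (cls (var 2)) M) ->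
    G |-- ElEq (elQuot p l) (elQuot p' l') (inst 0 p M)
| r_Quot_C G A R M a l :
    G |-- Ty set_ (Quot A R) -> Quot A R :: G |-- Ty coll M ->
    G |-- El a A ->
    A :: G |-- El l (inst 1 (cls (var 0)) M) ->
    R :: shift 1 A :: A :: G
      |-- ElEq (inst 3 (var 2) l) (inst 3 (var 1) l) (inst 3 (cls (var 2)) M) ->
    G |-- ElEq (elQuot (cls a) l) (inst 0 a l) (inst 0 (cls a) M)
| r_Quot_eff G A R a b :
    G |-- Ty set_ (Quot A R) -> G |-- El a A -> G |-- El b A ->
    G |-- ElEq (cls a) (cls b) (Quot A R) ->
    G |-- El true (inst2 0 a b R)

| r_P1_F G : G |-- Cont -> G |-- Ty coll P1
| r_P1_I G B : G |-- Ty prop_s B -> G |-- El (code B) P1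
| r_P1_eq G B C :
    G |-- Ty prop_s B -> G |-- Ty prop_s C -> G |-- El true (Iff B C) ->
    G |-- ElEq (code B) (code C) P1
| r_P1_eff G B C :
    G |-- Ty prop_s B -> G |-- Ty prop_s C ->
    G |-- ElEq (code B) (code C) P1 ->
    G |-- El true (Iff B C)
| r_P1_eta G U :
    G |-- El U P1 -> G |-- ElEq U (code (Eq P1 U (code Top))) P1

| r_Pow_F G A : G |-- Ty set_ A -> G |-- Ty coll (Pow A)
| r_Pow_eq G A A' :
    G |-- TyEq set_ A A' -> G |-- TyEq coll (Pow A) (Pow A')
| r_Pow_I G A b :
    G |-- Ty set_ A -> A :: G |-- El b P1 -> G |-- El (lam b) (Pow A)
| r_Pow_I_eq G A b b' :
    G |-- Ty set_ A -> A :: G |-- ElEq b b' P1 ->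
    G |-- ElEq (lam b) (lam b') (Pow A)
| r_Pow_E G A f a :
    G |-- Ty set_ A -> G |-- El f (Pow A) -> G |-- El a A ->
    G |-- El (app f a) P1
| r_Pow_beta G A b a :
    G |-- Ty set_ A -> A :: G |-- El b P1 -> G |-- El a A ->
    G |-- ElEq (app (lam b) a) (inst 0 a b) P1
| r_Pow_eta G A f :
    G |-- Ty set_ A -> G |-- El f (Pow A) ->
    G |-- ElEq (lam (app (shift 1 f) (var 0))) f (Pow A)

| r_prop_mono G B p q :
    G |-- Ty prop B -> G |-- El p B -> G |-- El q B -> G |-- ElEq p q B
| r_prop_true G B p : G |-- Ty prop B -> G |-- El p B -> G |-- El true B

| r_Fls_F G : G |-- Cont -> G |-- Ty prop_s Fls
| r_Fls_E G B : G |-- Ty prop B -> G |-- El true Fls -> G |-- El true B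

| r_And_F G s B C :
    G |-- Ty (prp s) B -> G |-- Ty (prp s) C -> G |-- Ty (prp s) (And B C)
| r_And_eq G s B B' C C' :
    G |-- TyEq (prp s) B B' -> G |-- TyEq (prp s) C C' ->
    G |-- TyEq (prp s) (And B C) (And B' C')
| r_And_I G B C :
    G |-- Ty prop B -> G |-- Ty prop C ->
    G |-- El true B -> G |-- El true C -> G |-- El true (And B C)
| r_And_E1 G B C :
    G |-- Ty prop B -> G |-- Ty prop C ->
    G |-- El true (And B C) -> G |-- El true B
| r_And_E2 G B C :
    G |-- Ty prop B -> G |-- Ty prop C ->
    G |-- El true (And B C) -> G |-- El true C

| r_Or_F G s B C :
    G |-- Ty (prp s) B -> G |-- Ty (prp s) C -> G |-- Ty (prp s) (Or B C)
| r_Or_eq G s B B' C C' :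
    G |-- TyEq (prp s) B B' -> G |-- TyEq (prp s) C C' ->
    G |-- TyEq (prp s) (Or B C) (Or B' C')
| r_Or_I1 G B C :
    G |-- Ty prop B -> G |-- Ty prop C ->
    G |-- El true B -> G |-- El true (Or B C)
| r_Or_I2 G B C :
    G |-- Ty prop B -> G |-- Ty prop C ->
    G |-- El true C -> G |-- El true (Or B C)
| r_Or_E G B C D :
    G |-- Ty prop B -> G |-- Ty prop C -> G |-- Ty prop D ->
    G |-- El true (Or B C) ->
    B :: G |-- El true (shift 1 D) -> C :: G |-- El true (shift 1 D) ->
    G |-- El true D

| r_Imp_F G s B C :
    G |-- Ty (prp s) B -> G |-- Ty (prp s) C -> G |-- Ty (prp s) (Imp B C)
| r_Imp_eq G s B B' C C' :
    G |-- TyEq (prp s) B B' -> G |-- TyEq (prp s) C C' ->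
    G |-- TyEq (prp s) (Imp B C) (Imp B' C')
| r_Imp_I G B C :
    G |-- Ty prop B -> G |-- Ty prop C ->
    B :: G |-- El true (shift 1 C) -> G |-- El true (Imp B C)
| r_Imp_E G B C :
    G |-- Ty prop B -> G |-- Ty prop C ->
    G |-- El true (Imp B C) -> G |-- El true B -> G |-- El true C

| r_All_F G s A B :
    G |-- Ty (typ s) A -> A :: G |-- Ty (prp s) B ->
    G |-- Ty (prp s) (All A B)
| r_All_eq G s A A' B B' :
    G |-- TyEq (typ s) A A' -> A :: G |-- TyEq (prp s) B B' ->
    G |-- TyEq (prp s) (All A B) (All A' B')
| r_All_I G A B :
    A :: G |-- Ty prop B -> A :: G |-- El true B -> G |-- El true (All A B)
| r_All_E G A B a :
    A :: G |-- Ty prop B -> G |-- El true (All A B) -> G |-- El a A ->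
    G |-- El true (inst 0 a B)

| r_Ex_F G s A B :
    G |-- Ty (typ s) A -> A :: G |-- Ty (prp s) B ->
    G |-- Ty (prp s) (Ex A B)
| r_Ex_eq G s A A' B B' :
    G |-- TyEq (typ s) A A' -> A :: G |-- TyEq (prp s) B B' ->
    G |-- TyEq (prp s) (Ex A B) (Ex A' B')
| r_Ex_I G A B a :
    A :: G |-- Ty prop B -> G |-- El a A -> G |-- El true (inst 0 a B) ->
    G |-- El true (Ex A B)
| r_Ex_E G A B D :
    A :: G |-- Ty prop B -> G |-- Ty prop D ->
    G |-- El true (Ex A B) ->
    B :: A :: G |-- El true (shift 2 D) ->
    G |-- El true D

(* [r_Eq_F_P1]: equality on P(1) is small although P(1) is not a set. *)
| r_Eq_F G s A a b :
    G |-- Ty (typ s) A -> G |-- El a A -> G |-- El b A ->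
    G |-- Ty (prp s) (Eq A a b)
| r_Eq_F_P1 G U V :
    G |-- El U P1 -> G |-- El V P1 -> G |-- Ty prop_s (Eq P1 U V)
| r_Eq_eq G s A A' a a' b b' :
    G |-- TyEq (typ s) A A' -> G |-- ElEq a a' A -> G |-- ElEq b b' A ->
    G |-- TyEq (prp s) (Eq A a b) (Eq A' a' b')
| r_Eq_I G A a : G |-- El a A -> G |-- El true (Eq A a a)
| r_Eq_E G A a b :
    G |-- El a A -> G |-- El b A -> G |-- El true (Eq A a b) ->
    G |-- ElEq a b A

| r_lem G B :
    L = classical -> G |-- Ty prop B -> G |-- El true (Or B (Neg B))

where "G |-- J" := (emTT _ G J).

(* An interpretation in the type theory with derivable judgements [T] consists
   of collections for the two sorts, open terms for the function symbols and an
   open proposition for membership.  In the contexts below the first argument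
   of a binary symbol has index 1 and the second one index 0. *)
Record interpretation (T : ctx -> judgement -> Prop) : Type := {
  i_num : expr;
  i_set : expr;
  i_zero : expr;
  i_succ : expr;
  i_plus : expr;
  i_times : expr;
  i_mem : expr;
  i_num_coll : T [] (Ty coll i_num);
  i_set_coll : T [] (Ty coll i_set);
  i_zero_num : T [] (El i_zero i_num);
  i_succ_num : T [i_num] (El i_succ i_num);
  i_plus_num : T [i_num; i_num] (El i_plus i_num);
  i_times_num : T [i_num; i_num] (El i_times i_num);
  i_mem_prop : T [i_set; i_num] (Ty prop i_mem)
}.

Section Translation.
Context {T : ctx -> judgement -> Prop} (I : interpretation T).

(* [u] and [v] give the values of the number variables and the set variables. *)
Fixpoint tr_nterm (u : nat -> expr) (t : nterm) : expr :=
  match t with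
  | nVar x => u x
  | nZero => i_zero T I
  | nSucc t => inst 0 (tr_nterm u t) (i_succ T I)
  | nPlus t t' => inst2 0 (tr_nterm u t) (tr_nterm u t') (i_plus T I)
  | nTimes t t' => inst2 0 (tr_nterm u t) (tr_nterm u t') (i_times T I)
  end.

(* Under a quantifier of one sort, the values of both sorts are weakened by the
   new variable, which becomes the value of the bound one ([up]).  The closed
   types [i_num] and [i_set] need no weakening. *)
Fixpoint tr_form (u v : nat -> expr) (p : form) : expr :=
  match p with
  | fEq t t' => Eq (i_num T I) (tr_nterm u t) (tr_nterm u t')
  | fIn t X => inst2 0 (tr_nterm u t) (v X) (i_mem T I)
  | fBot => Fls
  | fAnd p q => And (tr_form u v p) (tr_form u v q)
  | fOr p q => Or (tr_form u v p) (tr_form u v q)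
  | fImp p q => Imp (tr_form u v p) (tr_form u v q)
  | fAllN p => All (i_num T I) (tr_form (up u) (fun X => shift 1 (v X)) p)
  | fExN p => Ex (i_num T I) (tr_form (up u) (fun X => shift 1 (v X)) p)
  | fAllS p => All (i_set T I) (tr_form (fun x => shift 1 (u x)) (up v) p)
  | fExS p => Ex (i_set T I) (tr_form (fun x => shift 1 (u x)) (up v) p)
  end.

(* A formula with [n] free number variables and [m] free set variables is
   translated in a context declaring [n] numbers and, before them, [m] sets. *)
Definition tr_ctx (n m : nat) : ctx :=
  repeat (i_num T I) n ++ repeat (i_set T I) m.

Definition tr (n : nat) (p : form) : expr :=
  tr_form var (fun X => var (n + X)) p.

End Translation.

Definition interpretable
    (Th : form -> Prop) (T : ctx -> judgement -> Prop) : Prop :=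
  exists I : interpretation T,
    forall (n m : nat) (p : form), scoped n m p ->
      T (tr_ctx I n m) (Ty prop (tr I n p)) /\
      (Th p -> T (tr_ctx I n m) (El true (tr I n p))).

(* Main.v *)
(* Numbers are read in the set [List N1] and sets of numbers in its
   power-collection, [t] being in [X] when [X(t)] is the truth value [Top].
   Induction is elimination of lists towards an arbitrary proposition, a
   proposition being a collection.  Arithmetical formulas become small
   propositions, since their quantifiers range over a set and membership is an
   equality in [P1], so they have truth values, and comprehension holds by
   [X = lam (code phi)].  That [0] is not a successor is obtained by eliminating
   towards [P1], where [Top] and [Fls] have different codes.

   Soundness is proved as for a Kripke model: formulas are evaluated in every
   context under every valuation of the variables by terms of that context, so
   that hypotheses and eigenvariables are handled by extending the context. *)

From Stdlib Require Import List Lia PeanoNat FunctionalExtensionality.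
Require Import Defs.
Import ListNotations.

(** * Substitution in pre-terms *)

Ltac ext_var := apply functional_extensionality; intros [|?]; simpl.

Ltac rewrite_hyps :=
  repeat match goal with
    | IH : forall _, _ = _ |- _ => rewrite IH; clear IH
    | IH : forall _ _, _ = _ |- _ => rewrite IH; clear IH
    | IH : subst _ _ = _ |- _ => rewrite IH; clear IH
    end.

Lemma up_var (r : nat -> nat) :
  up (fun i => var (r i)) = fun i => var (up_ren r i).
Proof. ext_var; reflexivity. Qed.

(** Contexts are weakened by renaming, while the rules of emTT substitute; this identity passes
    between the two. *)
Lemma ren_as_subst (e : expr) :
  forall r, ren r e = subst (fun i => var (r i)) e.
Proof.
  induction e; intros r; simpl; rewrite_hyps; rewrite ?up_var; reflexivity.
Qed.

Lemma up_up_ren (s : nat -> expr) (r : nat -> nat) :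
  (fun i => up s (up_ren r i)) = up (fun i => s (r i)).
Proof. ext_var; reflexivity. Qed.

Lemma subst_ren (e : expr) :
  forall s r, subst s (ren r e) = subst (fun i => s (r i)) e.
Proof.
  induction e; intros s r; simpl; rewrite_hyps; rewrite ?up_up_ren; reflexivity.
Qed.

Lemma ren_ren (r r' : nat -> nat) (e : expr) :
  ren r (ren r' e) = ren (fun i => r (r' i)) e.
Proof.
  rewrite (ren_as_subst (ren r' e)), subst_ren. now rewrite ren_as_subst.
Qed.

Lemma ren_up (s : nat -> expr) (r : nat -> nat) :
  (fun i => ren (up_ren r) (up s i)) = up (fun i => ren r (s i)).
Proof.
  ext_var; [reflexivity|]. unfold shift. now rewrite !ren_ren.
Qed.

Lemma ren_subst (e : expr) :
  forall s r, ren r (subst s e) = subst (fun i => ren r (s i)) e.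
Proof.
  induction e; intros s r; simpl; rewrite_hyps; rewrite ?ren_up; reflexivity.
Qed.

Lemma subst_up (s t : nat -> expr) :
  (fun i => subst (up t) (up s i)) = up (fun i => subst t (s i)).
Proof.
  ext_var; [reflexivity|]. unfold shift. now rewrite subst_ren, ren_subst.
Qed.

Lemma up_id : up var = var.
Proof. ext_var; reflexivity. Qed.

Lemma subst_id (e : expr) : subst var e = e.
Proof. induction e; simpl; rewrite ?up_id; rewrite_hyps; reflexivity. Qed.

Lemma subst_shift (k : nat) (s : nat -> expr) (e : expr) :
  subst s (shift k e) = subst (fun i => s (k + i)) e.
Proof. apply subst_ren. Qed.

Lemma shift_as_subst (k : nat) (e : expr) :
  shift k e = subst (fun i => var (k + i)) e.
Proof. apply ren_as_subst. Qed.

Lemma shift_shift (j k : nat) (e : expr) :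
  shift j (shift k e) = shift (j + k) e.
Proof.
  unfold shift. rewrite ren_ren. f_equal.
  apply functional_extensionality; intros; lia.
Qed.

Lemma inst_shift (a e : expr) : inst 0 a (shift 1 e) = e.
Proof. unfold inst. rewrite subst_shift. apply subst_id. Qed.

(** * Arithmetic and comprehension in emTT *)

Section Derivability.
Context {L : logic}.
Local Notation "G |-- J" := (emTT L G J).

(** * Weakening and instantiation of one variable *)

Lemma weakening (D : ctx) (A : expr) (J : judgement) :
  A :: D |-- Cont -> D |-- Cont -> D |-- J ->
  A :: D |-- jsubst (fun i => var (S i)) J.
Proof.
  intros HA HD HJ. apply r_subst with (G := D); auto.
  intros n C Hn.
  replace (subst _ _) with (shift (S (S n)) C).
  - now apply r_var.
  - now rewrite subst_shift, shift_as_subst.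
Qed.

Lemma weaken_El (D : ctx) (A a B : expr) :
  A :: D |-- Cont -> D |-- Cont -> D |-- El a B ->
  A :: D |-- El (shift 1 a) (shift 1 B).
Proof.
  intros HA HD HJ. rewrite !shift_as_subst.
  exact (weakening D A (El a B) HA HD HJ).
Qed.

Lemma weaken_Ty (D : ctx) (A B : expr) (k : kind) :
  A :: D |-- Cont -> D |-- Cont -> D |-- Ty k B ->
  A :: D |-- Ty k (shift 1 B).
Proof.
  intros HA HD HJ. rewrite !shift_as_subst.
  exact (weakening D A (Ty k B) HA HD HJ).
Qed.

(** This is the premise of [r_subst_Ty] and [r_subst_El] for two substitutions that differ at
    variable 0 only; every other variable is equal to itself by reflexivity. *)
Lemma inst_valid_eq (D : ctx) (A a b : expr) :
  D |-- Cont -> D |-- ElEq a b A ->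
  forall n C, nth_error (A :: D) n = Some C ->
  D |-- ElEq (scons a var n) (scons b var n)
          (subst (scons a var) (shift (S n) C)).
Proof.
  intros HD Hab [|n] C Hn; simpl in Hn; rewrite subst_shift; simpl.
  - injection Hn as <-. now rewrite subst_id.
  - apply r_ElEq_refl. rewrite <- (shift_as_subst (S n)). now apply r_var.
Qed.

Lemma inst_TyEq (D : ctx) (k : kind) (A a b B : expr) :
  D |-- Cont -> A :: D |-- Ty k B -> D |-- ElEq a b A ->
  D |-- TyEq k (inst 0 a B) (inst 0 b B).
Proof.
  intros HD HB Hab. apply r_subst_Ty with (G := A :: D); auto.
  now apply inst_valid_eq.
Qed.

Lemma inst_valid (D : ctx) (A a : expr) :
  D |-- Cont -> D |-- El a A ->
  forall n C, nth_error (A :: D) n = Some C ->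
  D |-- El (scons a var n) (subst (scons a var) (shift (S n) C)).
Proof.
  intros HD Ha [|n] C Hn; simpl in Hn; rewrite subst_shift; simpl.
  - injection Hn as <-. now rewrite subst_id.
  - rewrite <- (shift_as_subst (S n)). now apply r_var.
Qed.

Lemma inst_Ty (D : ctx) (k : kind) (A a B : expr) :
  D |-- Cont -> A :: D |-- Ty k B -> D |-- El a A -> D |-- Ty k (inst 0 a B).
Proof.
  intros HD HB Ha.
  exact (r_subst L _ _ _ (scons a var) HB HD (inst_valid _ _ _ HD Ha)).
Qed.

Lemma inst_ElEq (D : ctx) (A a b c B : expr) :
  D |-- Cont -> A :: D |-- El c B -> D |-- ElEq a b A ->
  D |-- ElEq (inst 0 a c) (inst 0 b c) (inst 0 a B).
Proof.
  intros HD HB Hab. apply r_subst_El with (G := A :: D); auto.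
  now apply inst_valid_eq.
Qed.

(** Congruence of [Eq] makes [Eq A a a] and [Eq A a b] equal types, so the reflexivity proof
    converts from one to the other. *)
Lemma ElEq_Eq (D : ctx) (a b A : expr) :
  D |-- Ty (typ large) A -> D |-- ElEq a b A -> D |-- El a A ->
  D |-- El true (Eq A a b).
Proof.
  intros HA Hab Ha.
  apply r_conv with (Eq A a a); [now apply r_Eq_I|].
  apply (r_prp_typ_eq L D large), r_Eq_eq;
    [now apply r_TyEq_refl | now apply r_ElEq_refl | assumption].
Qed.

(** Elimination towards the proposition [Eq N1 (var 0) star] has a reflexivity as its only case, and
    reflection turns its conclusion into a judgemental equality. *)
Lemma N1_eta (D : ctx) (a : expr) :
  D |-- Cont -> D |-- El a N1 -> D |-- ElEq a star N1.
Proof.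
  intros HD Ha.
  assert (HN : D |-- Ty (typ small) N1) by now apply r_N1_F.
  assert (HC : N1 :: D |-- Cont) by now apply r_cons, r_set_coll.
  assert (HM : N1 :: D |-- Ty (prp small) (Eq N1 (var 0) star)).
  { apply r_Eq_F; [now apply r_N1_F| |now apply r_N1_I].
    exact (r_var L _ 0 N1 HC eq_refl). }
  apply r_Eq_E; [assumption|now apply r_N1_I|].
  apply r_prop_true with (elN1 a true).
  - apply r_prop_s_prop, r_Eq_F; auto. now apply r_N1_I.
  - apply (r_N1_E L D (Eq N1 (var 0) star)); auto.
    + now apply r_set_coll, (r_prp_typ L _ small).
    + apply r_Eq_I. now apply r_N1_I.
Qed.

(** * Natural numbers as lists over the singleton *)

Definition Nat : expr := List N1.
Definition succ_ (a : expr) : expr := snoc a star.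
Definition plus_ (a b : expr) : expr := elList b a (succ_ (var 0)).
(** Three nested [shift 1] are what [up (up (up s))] produces under the three binders of [elList],
    so that instances of [times_ (var 1) (var 0)] compute to this form. *)
Definition times_ (a b : expr) : expr :=
  elList b eps (plus_ (var 0) (shift 1 (shift 1 (shift 1 a)))).
Definition mem_ (a X : expr) : expr := Eq P1 (app X a) (code Top).

Lemma Nat_typ (D : ctx) (s : size) : D |-- Cont -> D |-- Ty (typ s) Nat.
Proof.
  intros HD. assert (D |-- Ty (typ small) Nat) by now apply r_List_F, r_N1_F.
  destruct s; [assumption|now apply r_set_coll].
Qed.

Lemma Pow_Nat_coll (D : ctx) : D |-- Cont -> D |-- Ty (typ large) (Pow Nat).
Proof. intros. now apply r_Pow_F, Nat_typ. Qed.

Lemma Nat_ctx (D : ctx) : D |-- Cont -> Nat :: D |-- Cont.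
Proof. intros. now apply r_cons, Nat_typ. Qed.

Lemma N1_ctx (D : ctx) : D |-- Cont -> N1 :: D |-- Cont.
Proof. intros. now apply r_cons, r_set_coll, r_N1_F. Qed.

Lemma Pow_Nat_ctx (D : ctx) : D |-- Cont -> Pow Nat :: D |-- Cont.
Proof. intros. now apply r_cons, Pow_Nat_coll. Qed.

Lemma var_El (D : ctx) (n : nat) (A B : expr) :
  D |-- Cont -> nth_error D n = Some A -> shift (S n) A = B ->
  D |-- El (var n) B.
Proof. intros HD Hn <-. now apply r_var. Qed.

Lemma zero_El (D : ctx) : D |-- Cont -> D |-- El eps Nat.
Proof. intros. now apply r_List_I1, r_N1_F. Qed.

Lemma succ_El (D : ctx) (a : expr) :
  D |-- Cont -> D |-- El a Nat -> D |-- El (succ_ a) Nat.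
Proof. intros. apply r_List_I2; auto using r_N1_F, r_N1_I. Qed.

(** The list eliminator has a step for an arbitrary last element of [N1], whereas a successor always
    appends [star]; the two agree by [N1_eta]. *)
Lemma snoc_eq (D : ctx) (a b : expr) :
  D |-- Cont -> D |-- El a Nat -> D |-- El b N1 ->
  D |-- ElEq (succ_ a) (snoc a b) Nat.
Proof.
  intros HD Ha Hb. assert (HC := N1_ctx _ HD).
  (* Both sides become instances of [snoc (shift 1 a) (var 0)], at [star] and at [b]. *)
  rewrite <- (inst_shift star a) at 1. rewrite <- (inst_shift b a) at 2.
  apply (inst_ElEq D N1 star b (snoc (shift 1 a) (var 0)) Nat); auto.
  - apply r_List_I2; [now apply r_N1_F|now apply (weaken_El D N1 a Nat)|].
    now apply var_El with N1.
  - now apply r_ElEq_sym, N1_eta.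
Qed.

Lemma rec_ctx (D : ctx) (M : expr) :
  D |-- Cont -> Nat :: D |-- Ty (typ large) M ->
  shift 1 M :: N1 :: Nat :: D |-- Cont.
Proof.
  intros HD HM. apply r_cons, weaken_Ty; auto using N1_ctx, Nat_ctx.
Qed.

Lemma rec_Nat_ctx (D : ctx) : D |-- Cont -> Nat :: N1 :: Nat :: D |-- Cont.
Proof. auto using Nat_ctx, N1_ctx. Qed.

Lemma plus_step_El (D : ctx) :
  D |-- Cont -> Nat :: N1 :: Nat :: D |-- El (succ_ (var 0)) Nat.
Proof.
  intros HD. apply succ_El; [|apply var_El with Nat]; auto using rec_Nat_ctx.
Qed.

Lemma plus_El (D : ctx) (a b : expr) :
  D |-- Cont -> D |-- El a Nat -> D |-- El b Nat -> D |-- El (plus_ a b) Nat.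
Proof.
  intros. apply (r_List_E L D N1 Nat);
    auto using r_N1_F, Nat_typ, Nat_ctx, plus_step_El.
Qed.

Lemma plus_zero (D : ctx) (a : expr) :
  D |-- Cont -> D |-- El a Nat -> D |-- ElEq (plus_ a eps) a Nat.
Proof.
  intros. apply (r_List_C1 L D N1 Nat);
    auto using r_N1_F, Nat_typ, Nat_ctx, plus_step_El.
Qed.

Lemma plus_succ (D : ctx) (a b : expr) :
  D |-- Cont -> D |-- El a Nat -> D |-- El b Nat ->
  D |-- ElEq (plus_ a (succ_ b)) (succ_ (plus_ a b)) Nat.
Proof.
  intros. apply (r_List_C2 L D N1 Nat);
    auto using r_N1_F, r_N1_I, Nat_typ, Nat_ctx, plus_step_El.
Qed.

Lemma times_step_El (D : ctx) (a : expr) :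
  D |-- Cont -> D |-- El a Nat ->
  Nat :: N1 :: Nat :: D
    |-- El (plus_ (var 0) (shift 1 (shift 1 (shift 1 a)))) Nat.
Proof.
  intros HD Ha. apply plus_El; [now apply rec_Nat_ctx| |].
  - apply var_El with Nat; auto using rec_Nat_ctx.
  - change Nat with (shift 1 (shift 1 (shift 1 Nat))) at 3.
    auto 7 using weaken_El, rec_Nat_ctx, Nat_ctx, N1_ctx.
Qed.

Lemma times_El (D : ctx) (a b : expr) :
  D |-- Cont -> D |-- El a Nat -> D |-- El b Nat -> D |-- El (times_ a b) Nat.
Proof.
  intros. apply (r_List_E L D N1 Nat);
    auto using r_N1_F, Nat_typ, Nat_ctx, times_step_El, zero_El.
Qed.

Lemma times_zero (D : ctx) (a : expr) :
  D |-- Cont -> D |-- El a Nat -> D |-- ElEq (times_ a eps) eps Nat.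
Proof.
  intros. apply (r_List_C1 L D N1 Nat);
    auto using r_N1_F, Nat_typ, Nat_ctx, times_step_El, zero_El.
Qed.

Lemma times_succ (D : ctx) (a b : expr) :
  D |-- Cont -> D |-- El a Nat -> D |-- El b Nat ->
  D |-- ElEq (times_ a (succ_ b)) (plus_ (times_ a b) a) Nat.
Proof.
  intros.
  (* The computation rule yields the step term with its three variables instantiated, which undoes
     the three weakenings of [a]. *)
  replace (plus_ (times_ a b) a) with
    (inst3 0 b star (times_ a b)
       (plus_ (var 0) (shift 1 (shift 1 (shift 1 a))))).
  - apply (r_List_C2 L D N1 Nat);
      auto using r_N1_F, r_N1_I, Nat_typ, Nat_ctx, times_step_El, zero_El.
  - unfold inst3, plus_, succ_. simpl. rewrite !subst_shift. simpl.
    now rewrite subst_id.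
Qed.

(** The recursion [elList _ eps (var 2)], whose step returns the shorter list, is the predecessor;
    it is applied to both sides of the equation. *)
Lemma pred_eq (D : ctx) (a b : expr) :
  D |-- Cont -> D |-- El a Nat -> D |-- El b Nat ->
  D |-- ElEq (succ_ a) (succ_ b) Nat -> D |-- ElEq a b Nat.
Proof.
  intros HD Ha Hb Hab.
  assert (Hstep : Nat :: N1 :: Nat :: D |-- El (var 2) Nat)
    by (apply var_El with Nat; auto using rec_Nat_ctx).
  assert (HM : Nat :: Nat :: D |-- Cont) by auto using Nat_ctx.
  assert (HC : forall c, D |-- El c Nat ->
            D |-- ElEq (elList (succ_ c) eps (var 2)) c Nat).
  { intros c Hc. apply (r_List_C2 L D N1 Nat);
      auto using r_N1_F, r_N1_I, Nat_typ, Nat_ctx, zero_El. }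
  apply r_ElEq_trans with (elList (succ_ a) eps (var 2));
    [now apply r_ElEq_sym, HC|].
  apply r_ElEq_trans with (elList (succ_ b) eps (var 2)); [|now apply HC].
  apply (r_List_E_eq L D N1 Nat);
    auto using r_N1_F, Nat_typ, Nat_ctx, r_ElEq_refl, zero_El.
Qed.

(** * Truth values in [P1] and comprehension *)

Lemma Top_small (D : ctx) : D |-- Cont -> D |-- Ty (prp small) Top.
Proof. intros. now apply r_Imp_F; apply r_Fls_F. Qed.

Lemma Top_true (D : ctx) : D |-- Cont -> D |-- El true Top.
Proof.
  intros HD. assert (HF : D |-- Ty (prp small) Fls) by now apply r_Fls_F.
  assert (HC : Fls :: D |-- Cont)
    by now apply r_cons, r_set_coll, (r_prp_typ L _ small).
  apply r_Imp_I; try now apply r_prop_s_prop.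
  apply r_prop_true with (var 0); [now apply r_prop_s_prop, r_Fls_F|].
  now apply var_El with Fls.
Qed.

Lemma succ_ne_zero (D : ctx) (a : expr) :
  D |-- Cont -> D |-- El a Nat -> D |-- ElEq (succ_ a) eps Nat ->
  D |-- El true Fls.
Proof.
  intros HD Ha He.
  assert (HM : Nat :: D |-- Ty (typ large) P1) by now apply r_P1_F, Nat_ctx.
  assert (HC := rec_ctx D P1 HD HM).
  assert (HT : D |-- El (code Top) P1) by now apply r_P1_I, Top_small.
  assert (HS : P1 :: N1 :: Nat :: D |-- El (code Fls) P1)
    by now apply r_P1_I, r_Fls_F.
  (* The two codes are the values of one recursion into [P1] at [eps] and at [succ_ a], which the
     assumed equation identifies; [r_P1_eff] then makes [Top] and [Fls] equivalent. *)
  assert (HTF : D |-- ElEq (code Top) (code Fls) P1).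
  { apply r_ElEq_trans with (elList eps (code Top) (code Fls)).
    - apply r_ElEq_sym, (r_List_C1 L D N1 P1); auto using r_N1_F.
    - apply r_ElEq_trans with (elList (succ_ a) (code Top) (code Fls)).
      + apply (r_List_E_eq L D N1 P1);
          auto using r_N1_F, r_ElEq_refl, r_ElEq_sym.
      + apply (r_List_C2 L D N1 P1); auto using r_N1_F, r_N1_I. }
  assert (HTs := Top_small _ HD). assert (HFs := r_Fls_F L _ HD).
  apply r_Imp_E with Top; auto using r_prop_s_prop, Top_true.
  apply r_And_E1 with (Imp Fls Top);
    auto using r_prop_s_prop, r_Imp_F.
  now apply r_P1_eff.
Qed.

Lemma prop_coll (D : ctx) (s : size) (B : expr) :
  D |-- Ty (prp s) B -> D |-- Ty (typ large) B.
Proof.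
  intros HB. apply (r_prp_typ L D large). destruct s; auto using r_prop_s_prop.
Qed.

(** The last variable of the context proves [B], and [r_prop_true] replaces it by the canonical
    proof. *)
Lemma hyp_true (D : ctx) (s : size) (B : expr) :
  D |-- Cont -> D |-- Ty (prp s) B -> B :: D |-- El true (shift 1 B).
Proof.
  intros HD HB. assert (HC := r_cons L _ _ (prop_coll _ _ _ HB)).
  apply r_prop_true with (var 0).
  - apply weaken_Ty; auto. destruct s; auto using r_prop_s_prop.
  - now apply var_El with B.
Qed.

(** From left to right, reflection gives an equality of codes and effectiveness gives [Imp Top B].
    Conversely, under the hypothesis [B] both [B] and [Top] are true, hence equivalent, and
    [r_P1_eq] equates their codes. *)
Lemma code_mem (D : ctx) (B : expr) :
  D |-- Cont -> D |-- Ty (prp small) B ->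
  D |-- El true (Iff (Eq P1 (code B) (code Top)) B).
Proof.
  intros HD HB.
  assert (HTs := Top_small _ HD).
  assert (HE : D |-- Ty (prp small) (Eq P1 (code B) (code Top)))
    by (apply r_Eq_F_P1; now apply r_P1_I).
  apply r_And_I; try (apply r_prop_s_prop, r_Imp_F; assumption);
    apply r_Imp_I; auto using r_prop_s_prop.
  - assert (HC := r_cons L _ _ (prop_coll _ _ _ HE)).
    assert (HB' := weaken_Ty _ _ _ _ HC HD HB).
    assert (HT' := Top_small _ HC).
    apply r_Imp_E with Top; auto using r_prop_s_prop, Top_true.
    apply r_And_E2 with (Imp (shift 1 B) Top);
      auto using r_prop_s_prop, r_Imp_F.
    apply r_P1_eff; auto.
    apply r_Eq_E; try now apply r_P1_I.
    exact (hyp_true _ _ _ HD HE).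
  - assert (HC := r_cons L _ _ (prop_coll _ _ _ HB)).
    assert (HB' := weaken_Ty _ _ _ _ HC HD HB).
    assert (HT' := Top_small _ HC).
    apply (ElEq_Eq (B :: D) (code (shift 1 B)) (code Top) P1);
      auto using r_P1_F, r_P1_I.
    apply r_P1_eq; auto.
    assert (HC2 : shift 1 B :: B :: D |-- Cont)
      by now apply r_cons, (prop_coll _ small).
    assert (HC3 : Top :: B :: D |-- Cont)
      by now apply r_cons, (prop_coll _ small).
    apply r_And_I; auto using r_prop_s_prop, r_Imp_F;
      apply r_Imp_I; auto using r_prop_s_prop.
    + now apply Top_true.
    + apply weaken_El with (a := true); auto. now apply (hyp_true _ small).
Qed.

Lemma comprehension (D : ctx) (a B : expr) :
  D |-- Cont -> Nat :: D |-- Ty (prp small) B -> D |-- El a Nat ->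
  D |-- El true (Iff (mem_ a (lam (code B))) (inst 0 a B)).
Proof.
  intros HD HB Ha.
  assert (HBa := inst_Ty _ _ _ _ _ HD HB Ha).
  apply r_conv with (Iff (Eq P1 (code (inst 0 a B)) (code Top)) (inst 0 a B)).
  - now apply code_mem.
  - assert (HE : D |-- TyEq (prp small)
              (Eq P1 (code (inst 0 a B)) (code Top)) (mem_ a (lam (code B)))).
    (* Both propositions are instances of the family [Eq P1 (var 0) (code Top)], so the beta
       equality between their arguments makes them equal. *)
    { change (Eq P1 (code (inst 0 a B)) (code Top)) with
        (inst 0 (code (inst 0 a B)) (Eq P1 (var 0) (code Top))).
      replace (mem_ a (lam (code B))) with
        (inst 0 (app (lam (code B)) a) (Eq P1 (var 0) (code Top)))
        by reflexivity.
      apply inst_TyEq with P1; auto.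
      - assert (HC : P1 :: D |-- Cont) by now apply r_cons, r_P1_F.
        apply r_Eq_F_P1; [now apply var_El with P1|].
        now apply r_P1_I, Top_small.
      - apply r_ElEq_sym, (r_Pow_beta L D Nat (code B) a);
          auto using Nat_typ, r_P1_I. }
    assert (Hr := r_TyEq_refl L _ _ _ HBa).
    apply r_set_coll_eq, (r_prp_typ_eq L D small).
    apply r_And_eq; apply r_Imp_eq; assumption.
Qed.
End Derivability.

Definition aca_interpretation (L : logic) : interpretation (emTT L).
Proof.
  refine {| i_num := Nat; i_set := Pow Nat; i_zero := eps;
            i_succ := succ_ (var 0); i_plus := plus_ (var 1) (var 0);
            i_times := times_ (var 1) (var 0);
            i_mem := mem_ (var 1) (var 0) |}.
  - apply Nat_typ, r_nil.
  - apply Pow_Nat_coll, r_nil.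
  - apply zero_El, r_nil.
  - assert (HC := Nat_ctx [] (r_nil L)).
    apply succ_El; [|apply var_El with Nat]; auto.
  - assert (HC := Nat_ctx _ (Nat_ctx [] (r_nil L))).
    apply plus_El; auto; apply var_El with Nat; auto.
  - assert (HC := Nat_ctx _ (Nat_ctx [] (r_nil L))).
    apply times_El; auto; apply var_El with Nat; auto.
  - assert (HC := Pow_Nat_ctx _ (Nat_ctx [] (r_nil L))).
    apply r_prop_s_prop, r_Eq_F_P1; [|now apply r_P1_I, Top_small].
    apply r_Pow_E with Nat; auto using Nat_typ.
    + now apply var_El with (Pow Nat).
    + now apply var_El with Nat.
Defined.

(** * Soundness *)

Section Soundness.
Context {L : logic}.
Local Notation "G |-- J" := (emTT L G J).
Local Notation trn := (tr_nterm (aca_interpretation L)).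
Local Notation trf := (tr_form (aca_interpretation L)).
Local Notation sh s := (fun i => shift 1 (s i)).

(** * Interaction of the translation with both substitutions *)

Lemma subst_up_shift (s : nat -> expr) (e : expr) :
  subst (up s) (shift 1 e) = shift 1 (subst s e).
Proof. unfold shift. now rewrite subst_ren, ren_subst. Qed.

Lemma subst_times (s : nat -> expr) (a b : expr) :
  subst s (times_ a b) = times_ (subst s a) (subst s b).
Proof.
  unfold times_, plus_. simpl. now rewrite !subst_up_shift.
Qed.

Lemma subst_trn (s u : nat -> expr) (t : nterm) :
  subst s (trn u t) = trn (fun x => subst s (u x)) t.
Proof.
  induction t as [x| |t IHt|t IHt t' IHt'|t IHt t' IHt']; try reflexivity.
  - change (succ_ (subst s (trn u t)) =
            succ_ (trn (fun x => subst s (u x)) t)). now rewrite IHt.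
  - change (plus_ (subst s (trn u t)) (subst s (trn u t')) =
            plus_ (trn (fun x => subst s (u x)) t)
                  (trn (fun x => subst s (u x)) t')). now rewrite IHt, IHt'.
  - change (subst s (times_ (trn u t) (trn u t')) =
            times_ (trn (fun x => subst s (u x)) t)
                   (trn (fun x => subst s (u x)) t')).
    now rewrite subst_times, IHt, IHt'.
Qed.

Lemma subst_up_sh (s v : nat -> expr) :
  (fun X => subst (up s) (shift 1 (v X))) = sh (fun X => subst s (v X)).
Proof. apply functional_extensionality; intros. apply subst_up_shift. Qed.

(** The interpreting types are closed and the symbols have no variables besides their arguments, so
    a substitution reaches a translated formula only through the two valuations. *)
Lemma subst_trf (p : form) : forall s u v,
  subst s (trf u v p) = trf (fun x => subst s (u x)) (fun X => subst s (v X)) p.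
Proof.
  induction p; intros s a b; simpl;
    rewrite ?subst_trn;
    repeat match goal with
      IH : forall _ _ _, _ = _ |- _ => rewrite IH; clear IH end;
    rewrite ?subst_up, ?subst_up_sh;
    reflexivity.
Qed.

Lemma shift_trf (u v : nat -> expr) (p : form) :
  shift 1 (trf u v p) = trf (sh u) (sh v) p.
Proof.
  rewrite shift_as_subst, subst_trf. f_equal;
    apply functional_extensionality; intros; symmetry; apply shift_as_subst.
Qed.

Lemma shift_trn (u : nat -> expr) (t : nterm) :
  shift 1 (trn u t) = trn (sh u) t.
Proof.
  rewrite shift_as_subst, subst_trn. f_equal;
    apply functional_extensionality; intros; symmetry; apply shift_as_subst.
Qed.

Lemma trn_nsubst (u : nat -> expr) (s : nat -> nterm) (t : nterm) :
  trn u (nsubst s t) = trn (fun x => trn u (s x)) t.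
Proof. induction t; simpl; congruence. Qed.

Lemma trn_nup (u : nat -> expr) (s : nat -> nterm) :
  (fun x => trn (up u) (nup s x)) = up (fun x => trn u (s x)).
Proof.
  ext_var; [reflexivity|].
  unfold nlift. rewrite trn_nsubst. symmetry. apply shift_trn.
Qed.

Lemma up_rup (v : nat -> expr) (r : nat -> nat) :
  (fun X => up v (rup r X)) = up (fun X => v (r X)).
Proof. ext_var; reflexivity. Qed.

Lemma sh_trn (u : nat -> expr) (s : nat -> nterm) :
  (fun x => trn (sh u) (s x)) = sh (fun x => trn u (s x)).
Proof. apply functional_extensionality; intros. symmetry. apply shift_trn. Qed.

(** Substitution in a formula is absorbed by the valuations; this reduces the instances and liftings
    in the rules of ACA to changes of valuation. *)
Lemma trf_fsubst (p : form) : forall s r u v,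
  trf u v (fsubst s r p) = trf (fun x => trn u (s x)) (fun X => v (r X)) p.
Proof.
  induction p; intros s r a b; simpl; rewrite ?trn_nsubst;
    repeat match goal with
      IH : forall _ _ _ _, _ = _ |- _ => rewrite IH; clear IH end;
    rewrite ?trn_nup, ?up_rup, ?sh_trn; reflexivity.
Qed.

Lemma trf_liftN (u v : nat -> expr) (p : form) :
  trf (up u) (sh v) (liftN p) = shift 1 (trf u v p).
Proof. unfold liftN. rewrite trf_fsubst, shift_trf. reflexivity. Qed.

Lemma trf_liftS (u v : nat -> expr) (p : form) :
  trf (sh u) (up v) (liftS p) = shift 1 (trf u v p).
Proof. unfold liftS. rewrite trf_fsubst, shift_trf. reflexivity. Qed.

Lemma inst_up (a : expr) (s : nat -> expr) :
  (fun i => subst (scons a var) (up s i)) = scons a s.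
Proof. ext_var; [reflexivity|]. apply inst_shift. Qed.

Lemma inst_sh (a : expr) (s : nat -> expr) :
  (fun i => subst (scons a var) (shift 1 (s i))) = s.
Proof. apply functional_extensionality; intros. apply inst_shift. Qed.

Lemma inst_trf_num (a : expr) (u v : nat -> expr) (p : form) :
  inst 0 a (trf (up u) (sh v) p) = trf (scons a u) v p.
Proof.
  change (subst (scons a var) (trf (up u) (sh v) p) = trf (scons a u) v p).
  now rewrite subst_trf, inst_up, inst_sh.
Qed.

Lemma inst_trf_set (a : expr) (u v : nat -> expr) (p : form) :
  inst 0 a (trf (sh u) (up v) p) = trf u (scons a v) p.
Proof.
  change (subst (scons a var) (trf (sh u) (up v) p) = trf u (scons a v) p).
  now rewrite subst_trf, inst_up, inst_sh.
Qed.

Lemma trf_instN (u v : nat -> expr) (t : nterm) (p : form) :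
  trf u v (instN t p) = trf (scons (trn u t) u) v p.
Proof. unfold instN. rewrite trf_fsubst. f_equal. ext_var; reflexivity. Qed.

Lemma trf_instS (u v : nat -> expr) (X : nat) (p : form) :
  trf u v (instS X p) = trf u (scons (v X) v) p.
Proof. unfold instS. rewrite trf_fsubst. f_equal. ext_var; reflexivity. Qed.

Lemma trn_scoped (u u' : nat -> expr) (n : nat) (t : nterm) :
  nscoped n t -> (forall x, x < n -> u x = u' x) -> trn u t = trn u' t.
Proof.
  induction t as [x| |t IH|t IH t' IH'|t IH t' IH'];
    simpl; intros Ht Hu; try destruct Ht; f_equal; auto.
Qed.

(** This permits arbitrary default values for the variables outside the scope. *)
Lemma trf_scoped (p : form) : forall n m u u' v v',
  scoped n m p -> (forall x, x < n -> u x = u' x) ->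
  (forall X, X < m -> v X = v' X) -> trf u v p = trf u' v' p.
Proof.
  assert (Hup : forall n (u u' : nat -> expr),
    (forall x, x < n -> u x = u' x) -> forall x, x < S n -> up u x = up u' x).
  { intros n u u' H [|x] Hx; simpl; [reflexivity|]. rewrite H; auto; lia. }
  assert (Hsh : forall n (u u' : nat -> expr),
    (forall x, x < n -> u x = u' x) -> forall x, x < n -> sh u x = sh u' x).
  { intros n u u' H x Hx. now rewrite H. }
  induction p; simpl; intros n m a a' b b' Hp Ha Hb;
    try destruct Hp as [Hp1 Hp2];
    rewrite ?(trn_scoped a a' n) by assumption; rewrite ?Hb by assumption;
    f_equal; eauto.
Qed.

(** * Valuations and well-formedness of translated formulas *)

Definition valuation (D : ctx) (u v : nat -> expr) : Prop :=
  D |-- Cont /\ (forall x, D |-- El (u x) Nat) /\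
  (forall X, D |-- El (v X) (Pow Nat)).

Lemma valuation_weaken (D : ctx) (A : expr) (u v : nat -> expr) :
  A :: D |-- Cont -> valuation D u v -> valuation (A :: D) (sh u) (sh v).
Proof.
  intros HA (HD & Hu & Hv). split; [assumption|split]; intros i.
  - now apply (weaken_El D A _ Nat).
  - now apply (weaken_El D A _ (Pow Nat)).
Qed.

Lemma valuation_num (D : ctx) (u v : nat -> expr) (a : expr) :
  valuation D u v -> D |-- El a Nat -> valuation D (scons a u) v.
Proof.
  intros (HD & Hu & Hv) Ha. split; [|split]; auto. intros [|x]; simpl; auto.
Qed.

Lemma valuation_set (D : ctx) (u v : nat -> expr) (a : expr) :
  valuation D u v -> D |-- El a (Pow Nat) -> valuation D u (scons a v).
Proof.
  intros (HD & Hu & Hv) Ha. split; [|split]; auto. intros [|x]; simpl; auto.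
Qed.

Lemma valuation_up_num (D : ctx) (u v : nat -> expr) :
  valuation D u v -> valuation (Nat :: D) (up u) (sh v).
Proof.
  intros H. assert (HC : Nat :: D |-- Cont) by now apply Nat_ctx, H.
  apply valuation_num; [now apply valuation_weaken|now apply var_El with Nat].
Qed.

Lemma valuation_up_set (D : ctx) (u v : nat -> expr) :
  valuation D u v -> valuation (Pow Nat :: D) (sh u) (up v).
Proof.
  intros H. assert (HC : Pow Nat :: D |-- Cont) by now apply Pow_Nat_ctx, H.
  apply valuation_set;
    [now apply valuation_weaken|now apply var_El with (Pow Nat)].
Qed.

Lemma trn_El (D : ctx) (u v : nat -> expr) (t : nterm) :
  valuation D u v -> D |-- El (trn u t) Nat.
Proof.
  intros (HD & Hu & Hv). induction t.
  - apply Hu.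
  - now apply zero_El.
  - now apply succ_El.
  - now apply plus_El.
  - now apply times_El.
Qed.

Lemma mem_small (D : ctx) (a X : expr) :
  D |-- Cont -> D |-- El a Nat -> D |-- El X (Pow Nat) ->
  D |-- Ty (prp small) (mem_ a X).
Proof.
  intros. apply r_Eq_F_P1; [|now apply r_P1_I, Top_small].
  apply r_Pow_E with Nat; auto using Nat_typ.
Qed.

(** The size parameter lets one induction show both that all formulas become propositions and that
    arithmetical ones become small; for [s = small] the set quantifiers are excluded by the
    hypothesis. *)
Lemma trf_Ty (p : form) : forall s D u v,
  (s = small -> arithmetical p) -> valuation D u v ->
  D |-- Ty (prp s) (trf u v p).
Proof.
  induction p; simpl; intros s D a b Hs H; destruct (H) as (HD & Ha & Hb).
  - apply r_Eq_F; [now apply Nat_typ| |]; now apply trn_El with b.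
  - assert (D |-- Ty (prp small) (mem_ (trn a t) (b X)))
      by (apply mem_small; auto; now apply trn_El with b).
    destruct s; [assumption|now apply r_prop_s_prop].
  - destruct s; [|apply r_prop_s_prop]; now apply r_Fls_F.
  - apply r_And_F; [apply IHp1|apply IHp2]; auto; intros Hz;
      now destruct (Hs Hz).
  - apply r_Or_F; [apply IHp1|apply IHp2]; auto; intros Hz;
      now destruct (Hs Hz).
  - apply r_Imp_F; [apply IHp1|apply IHp2]; auto; intros Hz;
      now destruct (Hs Hz).
  - apply r_All_F; [now apply Nat_typ|]. auto using valuation_up_num.
  - apply r_Ex_F; [now apply Nat_typ|]. auto using valuation_up_num.
  - destruct s; [now destruct Hs|].
    apply r_All_F; [now apply Pow_Nat_coll|].
    apply IHp; [discriminate|now apply valuation_up_set].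
  - destruct s; [now destruct Hs|].
    apply r_Ex_F; [now apply Pow_Nat_coll|].
    apply IHp; [discriminate|now apply valuation_up_set].
Qed.

Lemma trf_prop (p : form) (D : ctx) (u v : nat -> expr) :
  valuation D u v -> D |-- Ty (prp large) (trf u v p).
Proof. apply trf_Ty. discriminate. Qed.

Lemma trf_ctx (p : form) (D : ctx) (u v : nat -> expr) :
  valuation D u v -> trf u v p :: D |-- Cont.
Proof. intros. now apply r_cons, (prop_coll _ large), trf_prop. Qed.

(** * Truth of hypotheses and entailment in all contexts *)

Definition hyps_true (D : ctx) (u v : nat -> expr) (G : list form) : Prop :=
  forall q, In q G -> D |-- El true (trf u v q).

Definition entails (G : list form) (p : form) : Prop :=
  forall D u v, valuation D u v -> hyps_true D u v G ->
  D |-- El true (trf u v p).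

Lemma weaken_trf (D : ctx) (A : expr) (u v : nat -> expr) (q : form) :
  A :: D |-- Cont -> D |-- Cont -> D |-- El true (trf u v q) ->
  A :: D |-- El true (trf (sh u) (sh v) q).
Proof.
  intros HA HD H. rewrite <- shift_trf. now apply (weaken_El D A true).
Qed.

Lemma hyps_true_cons (D : ctx) (u v : nat -> expr) (p : form) (G : list form) :
  valuation D u v -> hyps_true D u v G ->
  hyps_true (trf u v p :: D) (sh u) (sh v) (p :: G).
Proof.
  intros H HG q [<-|Hq].
  - rewrite <- shift_trf. apply (hyp_true _ large);
      [apply H|now apply trf_prop].
  - apply weaken_trf; [now apply trf_ctx|apply H|now apply HG].
Qed.

Lemma hyps_true_liftN (D : ctx) (u v : nat -> expr) (G : list form) :
  valuation D u v -> hyps_true D u v G ->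
  hyps_true (Nat :: D) (up u) (sh v) (map liftN G).
Proof.
  intros H HG q Hq. apply in_map_iff in Hq as (q' & <- & Hq').
  rewrite trf_liftN.
  apply (weaken_El D Nat true); [apply Nat_ctx, H|apply H|auto].
Qed.

Lemma hyps_true_liftS (D : ctx) (u v : nat -> expr) (G : list form) :
  valuation D u v -> hyps_true D u v G ->
  hyps_true (Pow Nat :: D) (sh u) (up v) (map liftS G).
Proof.
  intros H HG q Hq. apply in_map_iff in Hq as (q' & <- & Hq').
  rewrite trf_liftS.
  apply (weaken_El D (Pow Nat) true); [apply Pow_Nat_ctx, H|apply H|auto].
Qed.

Lemma entails_cons (G : list form) (p q : form) (D : ctx) (u v : nat -> expr) :
  entails (p :: G) q -> valuation D u v -> hyps_true D u v G ->
  trf u v p :: D |-- El true (shift 1 (trf u v q)).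
Proof.
  intros Hq H HG. rewrite shift_trf.
  apply Hq; [apply valuation_weaken; [now apply trf_ctx|assumption]|].
  now apply hyps_true_cons.
Qed.

Lemma entails_impI (G : list form) (p q : form) :
  entails (p :: G) q -> entails G (fImp p q).
Proof.
  intros Hq D u v H HG. apply r_Imp_I; try now apply trf_prop.
  now apply entails_cons with G.
Qed.

Lemma entails_allNI (G : list form) (p : form) :
  entails (map liftN G) p -> entails G (fAllN p).
Proof.
  intros Hp D u v H HG. assert (H' := valuation_up_num _ _ _ H).
  apply r_All_I; [now apply trf_prop|].
  apply Hp; auto. now apply hyps_true_liftN.
Qed.

Lemma trf_allNE (D : ctx) (u v : nat -> expr) (p : form) (a : expr) :
  valuation D u v -> D |-- El true (trf u v (fAllN p)) -> D |-- El a Nat ->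
  D |-- El true (trf (scons a u) v p).
Proof.
  intros H Hp Ha. rewrite <- inst_trf_num.
  apply r_All_E with Nat; auto. now apply trf_prop, valuation_up_num.
Qed.

Lemma trf_impE (D : ctx) (u v : nat -> expr) (p q : form) :
  valuation D u v -> D |-- El true (trf u v (fImp p q)) ->
  D |-- El true (trf u v p) -> D |-- El true (trf u v q).
Proof.
  intros H Hpq Hp. apply r_Imp_E with (trf u v p); auto using trf_prop.
Qed.

(** Equal numbers instantiate the translated formula to equal types, so a proof moves along by
    conversion. *)
Lemma trf_replace (D : ctx) (u v : nat -> expr) (a b : expr) (p : form) :
  valuation D u v -> D |-- ElEq a b Nat ->
  D |-- El true (trf (scons a u) v p) -> D |-- El true (trf (scons b u) v p).
Proof.
  intros H Hab Hp. apply r_conv with (1 := Hp).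
  rewrite <- !inst_trf_num. apply (r_prp_typ_eq L D large).
  apply inst_TyEq with Nat; [apply H| |assumption].
  now apply trf_prop, valuation_up_num.
Qed.

Lemma trf_eqI (D : ctx) (u v : nat -> expr) (t t' : nterm) :
  valuation D u v -> D |-- ElEq (trn u t) (trn u t') Nat ->
  D |-- El true (trf u v (fEq t t')).
Proof.
  intros H He. apply (ElEq_Eq D (trn u t) (trn u t') Nat); auto.
  - apply Nat_typ, H.
  - now apply trn_El with v.
Qed.

Lemma trf_eqE (D : ctx) (u v : nat -> expr) (t t' : nterm) :
  valuation D u v -> D |-- El true (trf u v (fEq t t')) ->
  D |-- ElEq (trn u t) (trn u t') Nat.
Proof. intros H He. apply r_Eq_E; auto; now apply trn_El with v. Qed.

(** * Induction and comprehension *)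

Definition succ_subst : form -> form :=
  fsubst (scons (nSucc (nVar 0)) (fun x => nVar (S x))) (fun X => X).

Lemma trf_succ_subst (a : expr) (u v : nat -> expr) (p : form) :
  trf (scons a u) v (succ_subst p) = trf (scons (succ_ a) u) v p.
Proof.
  unfold succ_subst. rewrite trf_fsubst. f_equal. ext_var; reflexivity.
Qed.

Lemma trf_induction (D : ctx) (u v : nat -> expr) (p : form) (a : expr) :
  valuation D u v ->
  D |-- El true (trf u v (instN nZero p)) ->
  D |-- El true (trf u v (fAllN (fImp p (succ_subst p)))) ->
  D |-- El a Nat ->
  D |-- El true (trf (scons a u) v p).
Proof.
  intros H H0 HS Ha. destruct (H) as (HD & Hu & Hv).
  set (M := trf (up u) (sh v) p).
  assert (HM : Nat :: D |-- Ty (prp large) M)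
    by now apply trf_prop, valuation_up_num.
  (* The recursor towards the proposition [M] takes the canonical proof in both branches, and is
     itself replaced by [true] in the end. *)
  apply r_prop_true with (elList a true true);
    [now apply trf_prop, valuation_num|].
  rewrite <- inst_trf_num.
  apply (r_List_E L D N1 M); auto using r_N1_F.
  - now apply (prop_coll _ large).
  - unfold M. rewrite inst_trf_num. rewrite trf_instN in H0. exact H0.
  - assert (HC1 := Nat_ctx _ HD). assert (HC2 := N1_ctx _ HC1).
    assert (HC3 : shift 1 M :: N1 :: Nat :: D |-- Cont)
      by now apply rec_ctx, (prop_coll _ large).
    assert (H3 : valuation (shift 1 M :: N1 :: Nat :: D)
                   (sh (sh (sh u))) (sh (sh (sh v))))
      by auto using valuation_weaken.
    assert (HS3 : shift 1 M :: N1 :: Nat :: D |-- El true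
              (trf (sh (sh (sh u))) (sh (sh (sh v)))
                 (fAllN (fImp p (succ_subst p)))))
      by auto using weaken_trf.
    (* In the step context, [var 2] is the shorter list, [var 1] its appended element and [var 0]
       the induction hypothesis. *)
    assert (Hn : shift 1 M :: N1 :: Nat :: D |-- El (var 2) Nat)
      by now apply var_El with Nat.
    assert (Hs : shift 1 M :: N1 :: Nat :: D |-- El (var 1) N1)
      by now apply var_El with N1.
    replace (inst 3 (snoc (var 2) (var 1)) M) with
      (trf (scons (snoc (var 2) (var 1)) (sh (sh (sh u)))) (sh (sh (sh v))) p).
    (* The goal is moved from the appended element [var 1] to [star], where the induction premise
       for successors applies. *)
    + apply trf_replace with (succ_ (var 2)); auto using snoc_eq.
      rewrite <- trf_succ_subst. apply trf_impE with p.
      * now apply valuation_num.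
      * now apply trf_allNE with (p := fImp p (succ_subst p)).
      (* Two weakenings suffice for the induction hypothesis, since [M] already depends on the list
         variable. *)
      * replace (trf _ _ p) with (shift 1 (shift 1 M)).
        -- apply (hyp_true _ large); [assumption|].
           apply weaken_Ty; auto.
        -- unfold M. rewrite !shift_trf. f_equal. ext_var; reflexivity.
    + unfold M, inst. rewrite subst_trf. f_equal.
      * ext_var; [reflexivity|].
        rewrite !shift_shift, subst_shift. apply shift_as_subst.
      * apply functional_extensionality; intros X.
        rewrite !shift_shift, subst_shift. apply shift_as_subst.
Qed.

Lemma entails_comprehension (G : list form) (p : form) :
  arithmetical p -> entails G (fExS (fAllN (fIff (fIn (nVar 0) 0) (liftS p)))).
Proof.
  intros Hp D u v H _. destruct (H) as (HD & Hu & Hv).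
  (* Arithmeticity enters here: only a small proposition has a code in [P1]. *)
  assert (HB : Nat :: D |-- Ty (prp small) (trf (up u) (sh v) p))
    by auto using trf_Ty, valuation_up_num.
  set (X := lam (code (trf (up u) (sh v) p))).
  assert (HX : D |-- El X (Pow Nat)).
  { apply r_Pow_I; [now apply Nat_typ|now apply r_P1_I]. }
  apply r_Ex_I with X; [|assumption|].
  { now apply (trf_prop (fAllN _)), valuation_up_set. }
  change (D |-- El true (inst 0 X (trf (sh u) (up v)
            (fAllN (fIff (fIn (nVar 0) 0) (liftS p)))))).
  rewrite inst_trf_set.
  assert (H1 : valuation (Nat :: D) (up u) (sh (scons X v)))
    by auto using valuation_up_num, valuation_set.
  apply r_All_I; [exact (trf_prop (fIff (fIn (nVar 0) 0) (liftS p)) _ _ _ H1)|].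
  (* Under the number quantifier the witness [X] is weakened; [B] is the body of this weakened copy,
     its variable 0 being bound by [lam] and its variable 1 by the quantifier. *)
  set (B := trf (up (sh u)) (sh (sh v)) p).
  assert (HB' : Nat :: Nat :: D |-- Ty (prp small) B).
  { apply trf_Ty; auto.
    apply valuation_up_num, valuation_weaken; auto using Nat_ctx. }
  assert (HC := @comprehension L (Nat :: D) (var 0) B).
  replace (lam (code B)) with (shift 1 X) in HC.
  - replace (inst 0 (var 0) B) with
      (trf (up u) (sh (scons X v)) (liftS p)) in HC.
    + apply HC; auto using Nat_ctx. apply var_El with Nat; auto using Nat_ctx.
    (* The lifting [liftS] skips set variable 0, so the value [X] disappears from the right-hand
       side. *)
    + unfold B, liftS. rewrite inst_trf_num, trf_fsubst. reflexivity.
  - unfold X, B. rewrite shift_as_subst. simpl. do 2 f_equal.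
    rewrite subst_trf. f_equal.
    + rewrite subst_up. f_equal. apply functional_extensionality; intros.
      symmetry. apply shift_as_subst.
    + rewrite subst_up_sh. apply functional_extensionality; intros. f_equal.
      symmetry. apply shift_as_subst.
Qed.

(** Once [entails_allNI] has removed the quantifiers the valuation is again arbitrary, so the
    quantified numbers are simply [u 0] and [u 1], terms of an arbitrary context. *)
Lemma entails_axiom (G : list form) (p : form) : ACA_axiom p -> entails G p.
Proof.
  intros [| | | | | |q|q Hq].
  - apply entails_allNI, entails_impI. intros D u v H HG.
    assert (He := trf_eqE _ _ _ _ _ H (HG _ (or_introl eq_refl))).
    destruct H as (HD & Hu & _).
    exact (succ_ne_zero D (u 0) HD (Hu 0) He).
  - apply entails_allNI, entails_allNI, entails_impI. intros D u v H HG.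
    assert (He := trf_eqE _ _ _ _ _ H (HG _ (or_introl eq_refl))).
    apply trf_eqI; [assumption|]. destruct H as (HD & Hu & _).
    exact (pred_eq D (u 1) (u 0) HD (Hu 1) (Hu 0) He).
  - apply entails_allNI. intros D u v H _. apply trf_eqI; [assumption|].
    destruct H as (HD & Hu & _). exact (plus_zero D (u 0) HD (Hu 0)).
  - do 2 apply entails_allNI. intros D u v H _. apply trf_eqI; [assumption|].
    destruct H as (HD & Hu & _).
    exact (plus_succ D (u 1) (u 0) HD (Hu 1) (Hu 0)).
  - apply entails_allNI. intros D u v H _. apply trf_eqI; [assumption|].
    destruct H as (HD & Hu & _). exact (times_zero D (u 0) HD (Hu 0)).
  - do 2 apply entails_allNI. intros D u v H _. apply trf_eqI; [assumption|].
    destruct H as (HD & Hu & _).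
    exact (times_succ D (u 1) (u 0) HD (Hu 1) (Hu 0)).
  - do 2 apply entails_impI. intros D u v H HG.
    assert (HN := Nat_ctx _ (proj1 H)).
    apply r_All_I; [now apply trf_prop, valuation_up_num|].
    (* The goal under the quantifier is the instance at the new variable, as [up u] is
       [scons (var 0)] of the weakened valuation. *)
    apply (trf_induction (Nat :: D) (sh u) (sh v) q (var 0)).
    + now apply valuation_weaken.
    + apply weaken_trf; [assumption|apply H|]. apply HG; simpl; auto.
    + apply weaken_trf; [assumption|apply H|]. apply HG; simpl; auto.
    + now apply var_El with Nat.
  - now apply entails_comprehension.
Qed.

Lemma soundness (G : list form) (p : form) : deriv L G p -> entails G p.
Proof.
  induction 1 as
    [G p Hp|G p Hp|G p _ IH|G p q _ IH1 _ IH2|G p q _ IH|G p q _ IH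
    |G p q _ IH|G p q _ IH|G p q r _ IH _ IH1 _ IH2|G p q _ IH
    |G p q _ IH1 _ IH2|G p _ IH|G p t _ IH|G p t _ IH|G p q _ IH1 _ IH2
    |G p _ IH|G p X _ IH|G p X _ IH|G p q _ IH1 _ IH2|G t
    |G t t' p _ IH1 _ IH2|G p HL];
    intros D u v H HG; destruct (H) as (HD & Hu & Hv).
  - now apply (entails_axiom G).
  - now apply HG.
  - apply r_Fls_E; [now apply trf_prop|exact (IH D u v H HG)].
  - apply r_And_I; try now apply trf_prop.
    + exact (IH1 D u v H HG).
    + exact (IH2 D u v H HG).
  - apply r_And_E1 with (trf u v q);
      [now apply trf_prop|now apply trf_prop|exact (IH D u v H HG)].
  - apply r_And_E2 with (trf u v p);
      [now apply trf_prop|now apply trf_prop|exact (IH D u v H HG)].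
  - apply r_Or_I1;
      [now apply trf_prop|now apply trf_prop|exact (IH D u v H HG)].
  - apply r_Or_I2;
      [now apply trf_prop|now apply trf_prop|exact (IH D u v H HG)].
  - apply r_Or_E with (trf u v p) (trf u v q); try now apply trf_prop.
    + exact (IH D u v H HG).
    + now apply entails_cons with G.
    + now apply entails_cons with G.
  - now apply (entails_impI G).
  - apply trf_impE with p; [assumption|now apply IH1|now apply IH2].
  - now apply (entails_allNI G).
  - rewrite trf_instN.
    apply trf_allNE; [assumption|now apply IH|now apply trn_El with v].
  - apply r_Ex_I with (trn u t).
    + now apply trf_prop, valuation_up_num.
    + now apply trn_El with v.
    + rewrite inst_trf_num, <- trf_instN. now apply IH.
  - assert (H' := valuation_up_num _ _ _ H).
    apply r_Ex_E with Nat (trf (up u) (sh v) p);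
      [now apply trf_prop|now apply trf_prop|exact (IH1 D u v H HG)|].
    (* Eliminating an existential adds the witness and its proof to the context: the weakening by
       the witness is the lifting [liftN], and the one by the proof is handled by [entails_cons]. *)
    change 2 with (1 + 1). rewrite <- shift_shift, <- trf_liftN.
    apply (entails_cons (map liftN G)); auto. now apply hyps_true_liftN.
  - assert (H' := valuation_up_set _ _ _ H).
    apply r_All_I; [now apply trf_prop|].
    apply IH; auto. now apply hyps_true_liftS.
  - rewrite trf_instS, <- inst_trf_set.
    apply r_All_E with (Pow Nat); auto.
    + now apply trf_prop, valuation_up_set.
    + exact (IH D u v H HG).
  - apply r_Ex_I with (v X); auto.
    + now apply trf_prop, valuation_up_set.
    + rewrite inst_trf_set, <- trf_instS. now apply IH.
  - assert (H' := valuation_up_set _ _ _ H).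
    apply r_Ex_E with (Pow Nat) (trf (sh u) (up v) p);
      [now apply trf_prop|now apply trf_prop|exact (IH1 D u v H HG)|].
    change 2 with (1 + 1). rewrite <- shift_shift, <- trf_liftS.
    apply (entails_cons (map liftS G)); auto. now apply hyps_true_liftS.
  - apply trf_eqI; [assumption|]. apply r_ElEq_refl. now apply trn_El with v.
  - rewrite trf_instN. apply trf_replace with (trn u t); auto.
    + apply trf_eqE with v; [assumption|now apply IH1].
    + rewrite <- trf_instN. now apply IH2.
  (* Excluded middle carries the same condition on [L] in both systems, so one induction serves both
     logics. *)
  - apply r_lem; [assumption|now apply trf_prop].
Qed.

(** * The valuation of the declared variables *)

Lemma tr_ctx_Cont (n m : nat) : tr_ctx (aca_interpretation L) n m |-- Cont.
Proof.
  unfold tr_ctx. simpl. induction n as [|n IHn]; simpl.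
  - induction m as [|m IHm]; simpl; [apply r_nil|now apply Pow_Nat_ctx].
  - now apply Nat_ctx.
Qed.

(* Variables outside the scope get a default value, so that derivations may
   mention variables that are not declared in the context. *)
Definition num_value (n x : nat) : expr := if x <? n then var x else eps.
Definition set_value (n m X : nat) : expr :=
  if X <? m then var (n + X) else lam (code Fls).

Lemma valuation_tr_ctx (n m : nat) :
  valuation (tr_ctx (aca_interpretation L) n m)
    (num_value n) (set_value n m).
Proof.
  assert (HC := tr_ctx_Cont n m).
  split; [assumption|split]; intros i; unfold num_value, set_value.
  - destruct (Nat.ltb_spec i n); [|now apply zero_El].
    apply var_El with Nat; [assumption| |reflexivity].
    unfold tr_ctx. rewrite nth_error_app1 by (rewrite repeat_length; lia).
    now apply nth_error_repeat.
  - destruct (Nat.ltb_spec i m).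
    + apply var_El with (Pow Nat); [assumption| |reflexivity].
      unfold tr_ctx. rewrite nth_error_app2; rewrite repeat_length; [|lia].
      replace (n + i - n) with i by lia. now apply nth_error_repeat.
    + apply r_Pow_I; [now apply Nat_typ|].
      now apply r_P1_I, r_Fls_F, Nat_ctx.
Qed.

Lemma ACA_interpretable : interpretable (ACA L) (emTT L).
Proof.
  exists (aca_interpretation L). intros n m p Hp.
  assert (H := valuation_tr_ctx n m).
  (* On a scoped formula the defaults are invisible, so [tr] is the evaluation under a valuation to
     which soundness applies. *)
  replace (tr (aca_interpretation L) n p) with
    (trf (num_value n) (set_value n m) p).
  - split; [now apply trf_prop|]. intros Hd.
    apply (soundness [] p Hd); [assumption|]. intros q [].
  - apply trf_scoped with n m; auto; unfold num_value, set_value.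
    + intros x Hx. now destruct (Nat.ltb_spec x n); [|lia].
    + intros X HX. now destruct (Nat.ltb_spec X m); [|lia].
Qed.
End Soundness.

Theorem proposition6p10 :
  interpretable (ACA intuitionistic) (emTT intuitionistic) /\
  interpretable (ACA classical) (emTT classical).
Proof. split; apply ACA_interpretable. Qed.
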